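(* Let $\mathfrak{H},\mathfrak{K}$ be complex Hilbert spaces and let $T,B:\mathfrak{H}\to\mathfrak{K}$ be closed densely defined linear operators such that the following condition (a) or, equivalently, (b) holds: (a) $\mathrm{dom}\,B\subseteq\mathrm{dom}\,T$ and, for some $\lambda\ge0$, $\|Tf\|_{\mathfrak{K}}^2\le\lambda\,(Tf,Bf)_{\mathfrak{K}}$ for all $f\in\mathrm{dom}\,B$; (b) for some $\lambda\ge0$ there exists $X\in\mathbf{B}^+(\mathfrak{K})$ such that $\|X\|\le\lambda$ and $XB\subseteq T$. Let $X$ be an operator as in (b). Then the form $$\tau_{T,B}[f,g]:=(Tf,Bg)_{\mathfrak{K}},\qquad f,g\in\mathrm{dom}\,\tau_{T,B}:=\mathrm{dom}\,B,$$ is closable and its closure is given by $$\overline{\tau_{T,B}}[f,g]=\bigl(\overline{X^{1/2}B}\,f,\overline{X^{1/2}B}\,g\bigr)_{\mathfrak{K}}=\bigl(H^{1/2}f,H^{1/2}g\bigr)_{\mathfrak{H}},\qquad f,g\in\mathrm{dom}\,\overline{\tau_{T,B}},$$ where $H=B^*X^{1/2}\,\overline{X^{1/2}B}=H^*\ge0$. Here $H$ is the unique nonnegative selfadjoint operator representing the form $\overline{\tau_{T,B}}$, and $\mathrm{dom}\,\overline{\tau_{T,B}}=\mathrm{dom}\,H^{1/2}\subseteq\mathrm{dom}\,T$. Furthermore, with $\tau_T[f,g]:=(Tf,Tg)_{\mathfrak{K}}$, $f,g\in\mathrm{dom}\,T$, each of the following statements is equivalent to (a) and (b): (1) $\tau_T\le\lambda\,\tau_{T,B}$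 for some $\lambda\ge0$; (2) $\tau_T\le\lambda\,\overline{\tau_{T,B}}$ for some $\lambda\ge0$; (3) $T^*T\le\lambda H$ for some $\lambda\ge0$.
   Context: Operators are linear and possibly unbounded. $\mathbf{B}^+(\mathfrak{K})$ is the set of bounded everywhere defined nonnegative operators on $\mathfrak{K}$. Inclusion of operators is inclusion of graphs; in particular $XB\subseteq T$ means $\mathrm{dom}\,B\subseteq\mathrm{dom}\,T$ and $XBf=Tf$ for all $f\in\mathrm{dom}\,B$. $\overline{X^{1/2}B}$ denotes the operator closure of $X^{1/2}B$ (which is closable in this situation). A nonnegative form $\tau$ is closable if it has a closed extension; $\overline{\tau}$ denotes its closure (smallest closed extension). For a densely defined closed nonnegative form $\tau$ in $\mathfrak{H}$, the representing operator is the unique nonnegative selfadjoint operator $H$ with $\mathrm{dom}\,\tau=\mathrm{dom}\,H^{1/2}$ and $\tau[f,g]=(H^{1/2}f,H^{1/2}g)_{\mathfrak{H}}$. Write $\tau[f]=\tau[f,f]$. Ordering of forms: for nonnegative forms $\tau_1,\tau_2$ and $\lambda\ge0$, $\tau_1\le\lambda\tau_2$ means $\mathrm{dom}\,\tau_2\subseteq\mathrm{dom}\,\tau_1$ and $\tau_1[f]\le\lambda\tau_2[f]$ for all $f\in\mathrm{dom}\,\tau_2$. Ordering of operators is in the form sense: $T^*T\le\lambda H$ means $\mathrm{dom}\,H^{1/2}\subseteq\mathrm{dom}\,T$ and $\|Tf\|_{\mathfrak{K}}^2\le\lambda\|H^{1/2}f\|_{\mathfrak{H}}^2$ for all $f\in\mathrm{dom}\,H^{1/2}$.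 *)

(* Defs.v *)
Set Warnings "-notation-overridden,-ambiguous-paths,-notation-incompatible-prefix".
From HB Require Import structures.
From mathcomp Require Import all_boot all_order all_algebra.
From mathcomp Require Import boolp classical_sets reals topology normedtype.
From mathcomp Require Import complex.

Set Implicit Arguments.
Unset Strict Implicit.
Unset Printing Implicit Defensive.

Import Order.TTheory GRing.Theory Num.Theory.
Import numFieldNormedType.Exports.

Local Open Scope classical_set_scope.
Local Open Scope ring_scope.
Local Open Scope complex_scope.

(* [inner] is linear in its first argument and conjugate linear in its second. *)
HB.mixin Record isHilbert (R : realType) V of CompleteNormedModule R[i] V := {
  inner : {dot V for @Num.conj R[i]} ;
  inner_norm : forall u : V, inner u u = `|u| ^+ 2
}.

#[short(type="hilbertType")]
HB.structure Definition Hilbert (R : realType) :=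
  {V of CompleteNormedModule R[i] V & isHilbert R V}.

Notation "''[' f , g ]" := (inner f g) : ring_scope.

Section Operators.
Variable R : realType.

(* An operator is identified with its graph, so that equality and inclusion of
   operators are equality and inclusion of sets, and an operator is closed when
   its graph is [closed] for the product topology. *)
Section TwoSpaces.
Variables H K : hilbertType R.
Implicit Type A : set (H * K).

Definition linear_operator A : Prop :=
  [/\ A 0,
      forall (a : R[i]) (p q : H * K), A p -> A q -> A (a *: p + q)
    & forall f k k', A (f, k) -> A (f, k') -> k = k'].

Definition dom A : set H := [set f | exists k, A (f, k)].

(* The value of [A] at [f]; it is 0 when [f] is outside [dom A]. *)
Definition ap A (f : H) : K := xget 0 [set k | A (f, k)].

Definition densely_defined A : Prop := dense (dom A).

Definition adjoint A : set (K * H) :=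
  [set p | forall f k, A (f, k) -> '[k, p.1] = '[f, p.2]].

Definition closable_op A : Prop := linear_operator (closure A).

End TwoSpaces.

Definition op_comp (H K L : hilbertType R) (A : set (K * L)) (B : set (H * K)) :
    set (H * L) :=
  [set p | exists k, B (p.1, k) /\ A (k, p.2)].

Section OneSpace.
Variable H : hilbertType R.
Implicit Type A S : set (H * H).

Definition nonneg_op A : Prop := forall f, dom A f -> 0 <= '[ap A f, f].

Definition selfadjoint A : Prop :=
  [/\ linear_operator A, densely_defined A & adjoint A = A].

(* Every nonnegative selfadjoint operator, bounded or not, has exactly one such
   square root; the default value [set0] is only reached for other operators. *)
Definition op_sqrt A : set (H * H) :=
  xget set0 [set S | [/\ selfadjoint S, nonneg_op S & op_comp S S = A]].

Definition opnorm A : R :=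
  sup [set complex.Re `|ap A f| | f in [set f | `|f| <= 1]].

Definition bounded_nonneg A : Prop :=
  [/\ linear_operator A,
      dom A = setT,
      exists M : R, forall f, `|ap A f| <= M%:C * `|f|
    & nonneg_op A].

End OneSpace.

Section Forms.
Variable H : hilbertType R.

(* The values of [fval] outside [fdom] are irrelevant. *)
Record form := Form { fdom : set H ; fval :> H -> H -> R[i] }.

HB.instance Definition _ := gen_eqMixin form.
HB.instance Definition _ := gen_choiceMixin form.

Implicit Type s t : form.

Definition nonneg_form t : Prop :=
  [/\ fdom t 0,
      forall (a : R[i]) f g, fdom t f -> fdom t g -> fdom t (a *: f + g),
      forall (a : R[i]) f g h, fdom t f -> fdom t g -> fdom t h ->
        t (a *: f + g) h = a * t f h + t g h,
      forall (a : R[i]) f g h, fdom t f -> fdom t g -> fdom t h ->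
        t h (a *: f + g) = a^* * t h f + t h g
    & forall f, fdom t f -> 0 <= t f f].

Definition closed_form t : Prop :=
  nonneg_form t /\
  forall (u : nat -> H) (f : H), (forall n, fdom t (u n)) ->
    u @ \oo --> f ->
    (forall e : R, 0 < e ->
      \forall n \near \oo & m \near \oo, t (u n - u m) (u n - u m) < e%:C) ->
    fdom t f /\
    forall e : R, 0 < e -> \forall n \near \oo, t (u n - f) (u n - f) < e%:C.

Definition form_extends s t : Prop :=
  fdom t `<=` fdom s /\ forall f g, fdom t f -> fdom t g -> s f g = t f g.

Definition closable_form t : Prop :=
  nonneg_form t /\ exists s, closed_form s /\ form_extends s t.

Definition is_form_closure t s : Prop :=
  [/\ closed_form s, form_extends s t
    & forall s', closed_form s' -> form_extends s' t -> form_extends s' s].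

Definition form_closure t : form := xget t [set s | is_form_closure t s].

Definition form_le t1 (lambda : R) t2 : Prop :=
  fdom t2 `<=` fdom t1 /\
  forall f, fdom t2 f -> t1 f f <= lambda%:C * t2 f f.

Definition represents (A : set (H * H)) t : Prop :=
  [/\ selfadjoint A, nonneg_op A, fdom t = dom (op_sqrt A)
    & forall f g, fdom t f -> fdom t g ->
        t f g = '[ap (op_sqrt A) f, ap (op_sqrt A) g]].

End Forms.

Section Pair.
Variables H K : hilbertType R.
Implicit Types T B : set (H * K).

(* The form (Tf, Bg) on [dom B], meaningful when [dom B `<=` dom T]; the form
   (Tf, Tg) on [dom T] is [tau T T]. *)
Definition tau T B : form H := Form (dom B) (fun f g => '[ap T f, ap B g]).

Definition cond_a T B : Prop :=
  dom B `<=` dom T /\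
  exists2 lambda : R, 0 <= lambda &
    forall f, dom B f -> `|ap T f| ^+ 2 <= lambda%:C * '[ap T f, ap B f].

Definition factor_b T B (lambda : R) (X : set (K * K)) : Prop :=
  [/\ bounded_nonneg X, opnorm X <= lambda & op_comp X B `<=` T].

Definition cond_b T B : Prop :=
  exists2 lambda : R, 0 <= lambda & exists X, factor_b T B lambda X.

(* T^* T <= lambda A in the form sense. *)
Definition adjoint_mul_le T (lambda : R) (A : set (H * H)) : Prop :=
  dom (op_sqrt A) `<=` dom T /\
  forall f, dom (op_sqrt A) f ->
    `|ap T f| ^+ 2 <= lambda%:C * `|ap (op_sqrt A) f| ^+ 2.

(* The closure of [tau T B], and the operator representing it, are only
   meaningful once [tau T B] is a closable nonnegative form; this is therefore
   part of [cond_2] and [cond_3]. *)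
Definition cond_1 T B : Prop :=
  exists2 lambda : R, 0 <= lambda & form_le (tau T T) lambda (tau T B).

Definition cond_2 T B : Prop :=
  closable_form (tau T B) /\
  exists2 lambda : R, 0 <= lambda &
    form_le (tau T T) lambda (form_closure (tau T B)).

Definition cond_3 T B : Prop :=
  closable_form (tau T B) /\
  exists2 A : set (H * H), represents A (form_closure (tau T B)) &
  exists2 lambda : R, 0 <= lambda & adjoint_mul_le T lambda A.

End Pair.
End Operators.

(* Main.v *)
Require Import Defs.
From mathcomp Require Import all_boot all_order all_algebra.
From mathcomp Require Import boolp classical_sets reals topology normedtype.
From mathcomp Require Import functions sequences.
From mathcomp Require Import complex ring lra.

Set Implicit Arguments.
Unset Strict Implicit.
Unset Printing Implicit Defensive.

Import Order.TTheory GRing.Theory Num.Theory.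
Import numFieldNormedType.Exports.

Local Open Scope classical_set_scope.
Local Open Scope ring_scope.
Local Open Scope complex_scope.

(** Write the form as [(Tf, Bg) = (X B f, B g) = (X^(1/2) B f, X^(1/2) B g)].
    The operator [X^(1/2) B] is closable: if [f_n -> 0] and
    [X^(1/2) B f_n -> k], then [T f_n = X B f_n -> X^(1/2) k], so [X^(1/2) k = 0]
    because [T] is closed, while [k] is a limit of values of [X^(1/2)] and hence
    orthogonal to its kernel.  With [A] its closure, the form
    [(A f, A g)] is closed because [A] is, and it is the closure of [(Tf, Bg)]
    because [dom B] is a core of [A].  As [X^(1/2)] is bounded,
    [B^* X^(1/2) = (X^(1/2) B)^*], so [H = A^* A].  The same limit argument gives
    [T f = X^(1/2) A f] on [dom A], whence the domain inclusion and the
    inequalities [cond_1], [cond_2] and [cond_3] ([factor_main]).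

    Three facts of operator theory carry the proof.

    - A bounded nonnegative operator has a square root, commuting with whatever
      commutes with the operator ([sqrt_contr], [sqrt_bounded]).

    - For [A] closed and densely defined, [A^* A] is selfadjoint, has a nonnegative
      selfadjoint square root, and every such root has the domain and the form of
      [A] ([op_sqrt_mul_adjoint]).  Projecting [(h, 0)] onto the graph of [A]
      shows that [C = (1 + A^* A)^-1] is a nonnegative contraction
      ([mul_adjoint_resolvent]); [(1 - C)^(1/2) C^(-1/2)] is then a square root
      ([resolvent_sqrt]).  A nonnegative selfadjoint operator is recovered from its
      form ([represents_unique]).

    - Under [cond_a], the map [B f |-> T f] on the range of [B] extends to a nonnegative
      bounded operator [X] with norm at most the constant of [cond_a]
      ([nonneg_extension]), whence [cond_b].

    Completeness enters through a Riesz lemma, [riesz_approx], for forms that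
    are not assumed complete; it yields representation on subspaces
    ([riesz_op]) and projection onto closed graphs ([graph_projection]). *)

(** * Real inner product and convergence *)

Section RealInner.
Variable R : realType.
Implicit Types V : hilbertType R.

(** Real part of the inner product.  Most arguments take place in the underlying
    real Hilbert space; [complexify] recovers the complex inner product. *)
Definition ip V (u v : V) : R := complex.Re '[u, v].
(** The norm, as a real number. *)
Definition nr V (u : V) : R := complex.Re `|u|.

Lemma ReD (x y : R[i]) : complex.Re (x + y) = complex.Re x + complex.Re y.
Proof. by case: x y => [a b] [c d]. Qed.

Lemma ReN (x : R[i]) : complex.Re (- x) = - complex.Re x.
Proof. by case: x. Qed.

Lemma ReZ (a : R) (x : R[i]) : complex.Re (a%:C * x) = a * complex.Re x.
Proof. by case: x => [c d] /=; rewrite mul0r subr0. Qed.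

Lemma ge0_Re (x : R[i]) : 0 <= x -> x = (complex.Re x)%:C.
Proof. by case: x => a b; rewrite lecE /= => /andP[/eqP -> _]. Qed.

Lemma ge0_ReP (x : R[i]) : 0 <= x <-> complex.Im x = 0 /\ 0 <= complex.Re x.
Proof.
by case: x => a b; rewrite lecE /=; split=> [/andP[/eqP ? ?]|[-> ->]] //; rewrite eqxx.
Qed.

Section One.
Variable V : hilbertType R.
Implicit Types (u v w : V) (a b : R).

Lemma nrE u : `|u| = (nr u)%:C.
Proof. exact/ge0_Re/normr_ge0. Qed.

Lemma nr_ge0 u : 0 <= nr u.
Proof. by have := normr_ge0 u; rewrite nrE ler0c. Qed.

Lemma innerC u v : '[u, v] = ('[v, u])^*%C.
Proof. by rewrite (hermC (@inner R V)) /= expr0 mul1r. Qed.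

Lemma ipC u v : ip u v = ip v u.
Proof. by rewrite /ip innerC; case: '[v, u]. Qed.

Lemma ipDl u v w : ip (u + v) w = ip u w + ip v w.
Proof. by rewrite /ip linearDl ReD. Qed.
Lemma ipDr u v w : ip w (u + v) = ip w u + ip w v.
Proof. by rewrite ipC ipDl !(ipC w). Qed.
Lemma ipNl u v : ip (- u) v = - ip u v.
Proof. by rewrite /ip linearNl ReN. Qed.
Lemma ipNr u v : ip u (- v) = - ip u v.
Proof. by rewrite ipC ipNl ipC. Qed.
Lemma ipZl a u v : ip (a%:C *: u) v = a * ip u v.
Proof. by rewrite /ip linearZl_LR /= ReZ. Qed.
Lemma ipZr a u v : ip u (a%:C *: v) = a * ip u v.
Proof. by rewrite ipC ipZl ipC. Qed.
Lemma ip0l u : ip 0 u = 0. Proof. by rewrite /ip linear0l. Qed.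
Lemma ip0r u : ip u 0 = 0. Proof. by rewrite ipC ip0l. Qed.
Definition ipE := (ipDl, ipDr, ipNl, ipNr, ipZl, ipZr, ip0l, ip0r).

Lemma ip_i u v : ip ('i *: u) v = - complex.Im '[u, v].
Proof. by rewrite /ip linearZl_LR /=; case: '[u, v] => a b /=; ring. Qed.

Lemma innerE u v : '[u, v] = ip u v +i* (- ip ('i *: u) v).
Proof. by rewrite ip_i /ip opprK; case: '[u, v]. Qed.

Lemma ipii u v : ip ('i *: u) v = - ip u ('i *: v).
Proof. by rewrite ip_i ipC ip_i innerC; case: '[v, u]. Qed.

Lemma ipuu u : ip u u = nr u ^+ 2.
Proof. by rewrite /ip inner_norm nrE -rmorphXn. Qed.

Lemma ip_ge0 u : 0 <= ip u u.
Proof. by rewrite ipuu sqr_ge0. Qed.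

Lemma nr_eq0 u : nr u = 0 -> u = 0.
Proof. by move=> h; apply/eqP; rewrite -normr_eq0 nrE h. Qed.

Lemma ip_eq0 u : ip u u = 0 -> u = 0.
Proof. by rewrite ipuu => /eqP; rewrite sqrf_eq0 => /eqP /nr_eq0. Qed.

Lemma ip_eq u v : (forall w, ip u w = ip v w) -> u = v.
Proof.
move=> h; apply/eqP; rewrite -subr_eq0; apply/eqP/ip_eq0.
by rewrite ipDl ipNl h subrr.
Qed.

Lemma nr0 : nr (0 : V) = 0. Proof. by rewrite /nr normr0. Qed.
Lemma nrD u v : nr (u + v) <= nr u + nr v.
Proof. by rewrite -lecR rmorphD /= -!nrE ler_normD. Qed.
Lemma nrB u v : nr (u - v) = nr (v - u).
Proof. by rewrite /nr distrC. Qed.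
Lemma nrZ a u : nr (a%:C *: u) = `|a| * nr u.
Proof. by rewrite /nr normrZ normc_def /= expr0n /= addr0 sqrtr_sqr ReZ. Qed.
End One.

(** A nonnegative quadratic polynomial has nonpositive discriminant. *)
Lemma discr_le (a b c : R) : 0 <= a -> 
  (forall t : R, 0 <= a * t ^+ 2 + 2 * (b * t) + c) -> b ^+ 2 <= a * c.
Proof.
rewrite le_eqVlt => /orP[/eqP <- h|a0 h].
  rewrite mul0r; have [->|b0] := eqVneq b 0; first by rewrite expr0n.
  have := h (- (c + 1) / (2 * b)).
  suff -> : 0 * (- (c + 1) / (2 * b)) ^+ 2 + 2 * (b * (- (c + 1) / (2 * b))) + c = -1 by lra.
  by field.
have := h (- b / a).
have -> : a * (- b / a) ^+ 2 + 2 * (b * (- b / a)) + c = (a * c - b ^+ 2) / a.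
  by field; rewrite gt_eqF.
by rewrite pmulr_lge0 ?invr_gt0// subr_ge0.
Qed.

Lemma ip_CS V (u v : V) : ip u v ^+ 2 <= ip u u * ip v v.
Proof.
apply: discr_le; first exact: ip_ge0.
move=> t; suff -> : ip u u * t ^+ 2 + 2 * (ip u v * t) + ip v v =
  ip (t%:C *: u + v) (t%:C *: u + v) by exact: ip_ge0.
by rewrite !ipE (ipC v u); ring.
Qed.

Lemma ip_le V (u v : V) : `|ip u v| <= nr u * nr v.
Proof.
have h := ip_CS u v; rewrite -(ler_pXn2r (ltn0Sn 1)) ?nnegrE ?mulr_ge0 ?nr_ge0//.
by rewrite real_normK ?num_real// exprMn -!ipuu.
Qed.

(** An identity of inner products, complex linear in the first argument, may be
    checked on real parts, at [u] and at [i u]. *)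
Lemma complexify (V V' : hilbertType R) (u w : V) (u' w' : V') :
  ip u w = ip u' w' -> ip ('i *: u) w = ip ('i *: u') w' -> '[u, w] = '[u', w'].
Proof. by rewrite !innerE => -> ->. Qed.

(** The gauge [1 / (n + 1)]. *)
Definition inv_succ (n : nat) : R := n.+1%:R^-1.
Lemma inv_succ_gt0 n : 0 < inv_succ n.
Proof. by rewrite invr_gt0 ltr0n. Qed.

Lemma inv_succ_small (e : R) : 0 < e -> exists N, forall n, (N <= n)%N -> inv_succ n < e.
Proof.
move=> e0; exists (Num.bound e^-1) => n Nn.
rewrite /inv_succ invf_plt ?posrE ?ltr0n//.
apply: lt_le_trans (_ : (Num.bound e^-1)%:R <= _).
  by apply: le_lt_trans (archi_boundP _); [|rewrite invr_ge0 ltW].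
by rewrite ler_nat; apply: leq_trans Nn _.
Qed.

Lemma realC_lt (e : R[i]) : 0 < e -> exists2 d : R, 0 < d & d%:C = e.
Proof.
by move=> e0; exists (complex.Re e); rewrite -?ltcR -?ge0_Re// ltW.
Qed.

Lemma cvg_nrP V (u : nat -> V) (a : V) : u @ \oo --> a <->
  forall e : R, 0 < e -> exists N, forall n, (N <= n)%N -> nr (u n - a) < e.
Proof.
split=> [/cvgrPdist_lt h e e0|h].
  have /h [N _ hN] : 0 < e%:C :> R[i] by rewrite ltcR.
  by exists N => n Nn; have := hN n Nn; rewrite /= distrC nrE ltcR.
apply/cvgrPdist_lt => e e0; have [d d0 <-] := realC_lt e0.
have [N hN] := h _ d0; exists N => // n Nn /=.
by rewrite distrC nrE ltcR hN.
Qed.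

Lemma cvg_RP (u : nat -> R) (a : R) : u @ \oo --> a <->
  forall e : R, 0 < e -> exists N, forall n, (N <= n)%N -> `|u n - a| < e.
Proof.
split=> [/cvgrPdist_lt h e e0|h].
  have /h [N _ hN] := e0.
  by exists N => n Nn; have := hN n Nn; rewrite /= distrC.
apply/cvgrPdist_lt => e e0.
have [N hN] := h _ e0; exists N => // n Nn /=.
by rewrite distrC hN.
Qed.

Lemma cvgR_unique (u : nat -> R) (a b : R) :
  u @ \oo --> a -> u @ \oo --> b -> a = b.
Proof. by move=> ha hb; apply: (cvg_unique _ ha hb). Qed.

Lemma nr_complete V (u : nat -> V) :
  (forall e : R, 0 < e -> exists N, forall n m, (N <= n)%N -> (N <= m)%N ->
     nr (u n - u m) < e) -> exists a : V, u @ \oo --> a.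
Proof.
move=> h; suff /cauchy_cvgP/cvg_ex : cauchy (u @ \oo) by [].
apply/cauchyP => e e0; have [d d0 <-] := realC_lt e0.
have [N hN] := h _ d0; exists (u N); exists N => // n Nn /=.
by rewrite -ball_normE /ball_ /= nrE ltcR hN.
Qed.

Lemma cvg_ip V (u v : nat -> V) (a b : V) : u @ \oo --> a -> v @ \oo --> b ->
  (fun n => ip (u n) (v n)) @ \oo --> ip a b.
Proof.
move=> /cvg_nrP hu /cvg_nrP hv; apply/cvg_RP => e e0.
pose M := nr a + nr b + 1.
have M0 : 0 < M by rewrite /M; have := nr_ge0 a; have := nr_ge0 b; lra.
pose d := Num.min 1 (e / (2 * M)).
have d0 : 0 < d by rewrite lt_min ltr01 divr_gt0// mulr_gt0// ltr0n.
have [N hN] := hu _ d0; have [N' hN'] := hv _ d0.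
exists (maxn N N') => n; rewrite geq_max => /andP[/hN h1 /hN' h2].
have -> : ip (u n) (v n) - ip a b = ip (u n - a) b + ip a (v n - b) + ip (u n - a) (v n - b).
  by rewrite !ipE; ring.
have hd1 : d <= 1 by rewrite ge_min lexx.
have hd2 : d * (2 * M) <= e by rewrite -ler_pdivlMr ?mulr_gt0 ?ltr0n// ge_min lexx orbT.
have h3 : `|ip (u n - a) b| <= d * nr b.
  by apply: le_trans (ip_le _ _) _; rewrite ler_wpM2r ?nr_ge0 ?ltW.
have h4 : `|ip a (v n - b)| <= d * nr a.
  by apply: le_trans (ip_le _ _) _; rewrite mulrC ler_wpM2r ?nr_ge0 ?ltW.
have h5 : `|ip (u n - a) (v n - b)| <= d * 1.
  apply: le_trans (ip_le _ _) _; rewrite ler_pM ?nr_ge0 ?(ltW h1)//.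
  exact: ltW (lt_le_trans h2 hd1).
have := ler_normD (ip (u n - a) b + ip a (v n - b)) (ip (u n - a) (v n - b)).
have := ler_normD (ip (u n - a) b) (ip a (v n - b)).
have : 0 < d * M by rewrite mulr_gt0.
rewrite /M in hd2 *; lra.
Qed.

Lemma cvg_ipr V (w : V) (u : nat -> V) (a : V) : u @ \oo --> a ->
  (fun n => ip w (u n)) @ \oo --> ip w a.
Proof. by apply: cvg_ip; exact: cvg_cst. Qed.

Lemma cvg_ipl V (w : V) (u : nat -> V) (a : V) : u @ \oo --> a ->
  (fun n => ip (u n) w) @ \oo --> ip a w.
Proof. by move=> ua; apply: (cvg_ip ua); exact: cvg_cst. Qed.

Lemma cvg_bounded V V' (F : V -> V') (M : R) (u : nat -> V) a :
  (forall x y, F (x - y) = F x - F y) -> (forall x, nr (F x) <= M * nr x) ->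
  u @ \oo --> a -> (fun n => F (u n)) @ \oo --> F a.
Proof.
move=> FB FM /cvg_nrP h; apply/cvg_nrP => e e0.
pose M' := `|M| + 1; have M0 : 0 < M' by rewrite /M'; have := normr_ge0 M; lra.
have [N hN] := h (e / M') (divr_gt0 e0 M0); exists N => n /hN.
rewrite ltr_pdivlMr// -FB => h1; apply: le_lt_trans h1; apply: le_trans (FM _) _.
rewrite mulrC ler_wpM2l ?nr_ge0// /M'; have := ler_norm M; lra.
Qed.

Lemma closureP_seq (T : pseudoMetricType R[i]) (E : set T) (x : T) :
  closure E x <-> exists2 u : nat -> T, (forall n, E (u n)) & u @ \oo --> x.
Proof.
split=> [Ex|[u Eu ux] B /ux [N _ hN]]; last by exists (u N); split; [|exact: (hN N (leqnn _))].
have h n : exists y, E y /\ ball x (inv_succ n)%:C y.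
  by apply: Ex; apply: nbhsx_ballx; rewrite ltcR inv_succ_gt0.
have [u hu] := choice h; exists u => [n|]; first by have [] := hu n.
apply/cvg_ballP => e e0; have [d d0 <-] := realC_lt e0.
have [N hN] := inv_succ_small d0; exists N => // n Nn /=.
have [_] := hu n; apply: le_ball; rewrite lecR; exact/ltW/hN.
Qed.

Lemma cvg_pairP V V' (u : nat -> V * V') (f : V) (k : V') : u @ \oo --> (f, k) <->
  (fun n => (u n).1) @ \oo --> f /\ (fun n => (u n).2) @ \oo --> k.
Proof.
split=> [h|[h1 h2]].
  split; first exact: (cvg_comp u fst h cvg_fst).
  exact: (cvg_comp u snd h cvg_snd).
suff -> : u = (fun n => ((u n).1, (u n).2)) by exact: cvg_pair h1 h2.
by apply/funext => n; case: (u n).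
Qed.

Lemma closure_pairP V V' (A : set (V * V')) f k : closure A (f, k) <->
  exists u v, [/\ forall n, A (u n, v n), u @ \oo --> f & v @ \oo --> k].
Proof.
rewrite closureP_seq; split=> [[w hw /cvg_pairP[h1 h2]]|[u [v [h1 h2 h3]]]].
  by exists (fun n => (w n).1), (fun n => (w n).2); split=> // n; case: (w n) (hw n).
by exists (fun n => (u n, v n)) => //; exact/cvg_pairP.
Qed.

Lemma closed_pair V V' (A : set (V * V')) u v f k : closed A ->
  (forall n, A (u n, v n)) -> u @ \oo --> f -> v @ \oo --> k -> A (f, k).
Proof.
by move=> cA *; rewrite ((closure_id A).1 cA); apply/closure_pairP; exists u, v.
Qed.

End RealInner.

Arguments cvg_ipr [R V] w [u a].
Arguments cvg_ipl [R V] w [u a].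

(** * Riesz representation and projections *)

Section Riesz.
Variable R : realType.

Definition subspace (V : lmodType R[i]) (D : set V) : Prop :=
  D 0 /\ forall (a : R[i]) x y, D x -> D y -> D (a *: x + y).

Section Subspace.
Variables (V : lmodType R[i]) (D : set V).
Hypothesis sD : subspace D.

Lemma subspace0 : D 0. Proof. by case: sD. Qed.
Lemma subspaceP a x y : D x -> D y -> D (a *: x + y).
Proof. by case: sD => _; exact. Qed.
Lemma subspaceZ a x : D x -> D (a *: x).
Proof. by move=> Dx; rewrite -[_ *: _]addr0; exact: subspaceP subspace0. Qed.
Lemma subspaceD x y : D x -> D y -> D (x + y).
Proof. by move=> Dx Dy; rewrite -[x]scale1r; exact: subspaceP. Qed.
Lemma subspaceB x y : D x -> D y -> D (x - y).
Proof. by move=> Dx Dy; rewrite -scaleN1r addrC; exact: subspaceP. Qed.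
End Subspace.

(** [j] is complex linear on [D]; its values elsewhere are irrelevant. *)
Definition rlin_on (V W : lmodType R[i]) (D : set V) (j : V -> W) : Prop :=
  forall (a : R[i]) x y, D x -> D y -> j (a *: x + y) = a *: j x + j y.

Section RlinOn.
Variables (V W : lmodType R[i]) (D : set V) (j : V -> W).
Hypotheses (sD : subspace D) (jl : rlin_on D j).

Lemma rlin0 : j 0 = 0.
Proof.
have := jl (-1) (subspace0 sD) (subspace0 sD).
by rewrite scaler0 addr0 scaleN1r addNr.
Qed.
Lemma rlinD x y : D x -> D y -> j (x + y) = j x + j y.
Proof. by move=> Dx Dy; rewrite -{1}[x]scale1r jl// scale1r. Qed.
Lemma rlinZ a x : D x -> j (a *: x) = a *: j x.
Proof. by move=> Dx; rewrite -[_ *: x]addr0 jl ?rlin0 ?addr0//; exact: subspace0. Qed.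
Lemma rlinB x y : D x -> D y -> j (x - y) = j x - j y.
Proof. by move=> Dx Dy; rewrite -scaleN1r addrC jl// scaleN1r addrC. Qed.
End RlinOn.

(** A functional [phi] on a subspace [D], bounded for a nonnegative symmetric real
    bilinear form [p] that need not be complete: representing vectors exist up to
    an arbitrarily small error.  They are almost minimizers of
    [p x x - 2 phi x], and they form a Cauchy sequence for [p], so that each
    application only has to supply its own limit. *)
Section Abstract.
Variables (V : lmodType R[i]) (D : set V) (p : V -> V -> R) (phi : V -> R) (c : R).
Hypotheses (sD : subspace D)
  (psym : forall x y, D x -> D y -> p x y = p y x)
  (plin : forall (a : R) x y z, D x -> D y -> D z ->
     p (a%:C *: x + y) z = a * p x z + p y z)
  (p0 : forall x, D x -> 0 <= p x x)
  (philin : forall (a : R) x y, D x -> D y -> phi (a%:C *: x + y) = a * phi x + phi y)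
  (c0 : 0 <= c)
  (phic : forall x, D x -> phi x ^+ 2 <= c * p x x).

Lemma riesz_approx : exists u : nat -> V, forall n, D (u n) /\
  forall x, D x -> (p x (u n) - phi x) ^+ 2 <= inv_succ R n * p x x.
Proof.
pose J x := p x x - 2 * phi x.
have Jlb x : D x -> - c <= J x.
  move=> Dx; have := phic Dx; have := p0 Dx; rewrite /J.
  move: (p x x) (phi x) => P f P0 h; rewrite leNgt; apply/negP => h1.
  have : (P + c) ^+ 2 < (2 * f) ^+ 2.
    have Pc : 0 <= P + c by apply: addr_ge0.
    by rewrite ltr_pXn2r ?nnegrE//; lra.
  have := sqr_ge0 (P - c); nra.
have infJ : has_inf [set J x | x in D].
  split; first by exists (J 0), 0 => //; exact: (subspace0 sD).
  by exists (- c) => _ [x Dx <-]; exact: Jlb.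
suff h n : exists un, D un /\ forall x, D x ->
    (p x un - phi x) ^+ 2 <= inv_succ R n * p x x.
  by have [u hu] := choice h; exists u.
have [_ [u Du <-] hu] := inf_adherent (inv_succ_gt0 R n) infJ.
(* Perturbing the almost minimizer u along x bounds a discriminant. *)
exists u; split=> // x Dx; rewrite mulrC; apply: discr_le (p0 Dx) _ => t.
have Dtx : D (t%:C *: x + u) by exact: subspaceP.
have h : inf [set J x | x in D] <= J (t%:C *: x + u).
  by apply: ge_inf; [case: infJ|exists (t%:C *: x + u)].
have := lt_le_trans hu (lerD h (lexx _)); rewrite /J philin// plin//.
rewrite (psym Dx Dtx) (psym Du Dtx) !plin// (psym Du Dx); lra.
Qed.

Lemma riesz_cauchy (u : nat -> V) :
  (forall n, D (u n) /\
     forall x, D x -> (p x (u n) - phi x) ^+ 2 <= inv_succ R n * p x x) ->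
  forall e : R, 0 < e -> exists N, forall n m, (N <= n)%N -> (N <= m)%N ->
    p (u n - u m) (u n - u m) < e.
Proof.
move=> hu e e0; have e4 : 0 < e / 4 by lra.
have [N hN] := inv_succ_small e4; exists N => n m /hN hn /hN hm.
have [[Dn kn] [Dm km]] := (hu n, hu m).
set x := u n - u m; have Dx : D x by exact: subspaceB.
have xE : x = ((-1 : R)%:C *: u m + u n) by rewrite rmorphN1 scaleN1r addrC.
have h : p x x = (p x (u n) - phi x) - (p x (u m) - phi x).
  by rewrite {1}xE plin// (psym Dn Dx) (psym Dm Dx); lra.
have := kn x Dx; have := km x Dx; have := p0 Dx.
move: h; move: (p x (u n) - phi x) (p x (u m) - phi x) (p x x) => al be P h P0 h1 h2.
have h3 : P ^+ 2 <= 2 * (inv_succ R n + inv_succ R m) * P.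
  rewrite {1}h; have := sqr_ge0 (al + be); lra.
move: P0; rewrite le_eqVlt => /orP[/eqP <-//|P0].
have : P <= 2 * (inv_succ R n + inv_succ R m) by rewrite -(ler_pM2r P0) -expr2.
lra.
Qed.
End Abstract.

(** The representing vector is found in the closure of the subspace [j D], on
    which alone the functional is prescribed. *)
Lemma riesz (V : lmodType R[i]) (W : hilbertType R) (D : set V) (j : V -> W)
    (phi : V -> R) (c : R) :
  subspace D -> rlin_on D j ->
  (forall (a : R) x y, D x -> D y -> phi (a%:C *: x + y) = a * phi x + phi y) ->
  0 <= c -> (forall x, D x -> phi x ^+ 2 <= c * nr (j x) ^+ 2) ->
  exists z, [/\ closure (j @` D) z, nr z ^+ 2 <= c &
    forall x, D x -> ip (j x) z = phi x].
Proof.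
move=> sD jl phil c0 hc; pose p x y := ip (j x) (j y).
have psym x y : D x -> D y -> p x y = p y x by rewrite /p ipC.
have plin (a : R) x y z : D x -> D y -> D z ->
    p (a%:C *: x + y) z = a * p x z + p y z.
  by move=> Dx Dy Dz; rewrite /p jl// !ipE.
have p0 x : D x -> 0 <= p x x by move=> _; exact: ip_ge0.
have phic x : D x -> phi x ^+ 2 <= c * p x x by move=> /hc; rewrite /p ipuu.
have [u hu] := riesz_approx sD psym plin p0 phil c0 phic.
have Du n : D (u n) by have [] := hu n.
have [z uz] : exists z : W, (fun n => j (u n)) @ \oo --> z.
  apply: nr_complete => e e0.
  have [N hN] := riesz_cauchy sD psym plin p0 hu (exprn_gt0 2 e0).
  exists N => n m /hN h /h; rewrite /p (rlinB jl); [|exact: Du|exact: Du]; rewrite ipuu.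
  by rewrite ltr_pXn2r ?nnegrE ?nr_ge0// ltW.
have hz x : D x -> ip (j x) z = phi x.
  move=> Dx; have h1 := cvg_ipr (j x) uz.
  apply: (cvgR_unique h1); apply/cvg_RP => e e0.
  have P0 := ip_ge0 (j x).
  have [N hN] := @inv_succ_small R (e ^+ 2 / (ip (j x) (j x) + 1)) ltac:(apply: divr_gt0; [exact: exprn_gt0|lra]).
  exists N => n /hN hn; have [_ /(_ x Dx)] := hu n; rewrite -/(p x (u n)) => k.
  rewrite -(ltr_pXn2r (ltn0Sn 1)) ?nnegrE ?normr_ge0 ?(ltW e0)//.
  rewrite real_normK ?num_real//; apply: le_lt_trans k _.
  move: hn; rewrite ltr_pdivlMr; last lra.
  rewrite /p; have := inv_succ_gt0 R n; lra.
exists z; split=> //.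
  by apply/closureP_seq; exists (fun n => j (u n)) => // n; exists (u n).
have h2 : (fun n => ip (j (u n)) z ^+ 2) @ \oo --> ip z z ^+ 2.
  have k := cvg_ipl z uz; exact: (cvgM k k).
have h3 : (fun n => c * ip (j (u n)) (j (u n))) @ \oo --> c * ip z z.
  by apply: cvgMr; exact: cvg_ip.
have h : ip z z ^+ 2 <= c * ip z z.
  apply: ler_cvg_to h2 h3 _; near=> n.
  by rewrite hz// ipuu hc.
rewrite -ipuu; have := ip_ge0 z; rewrite le_eqVlt => /orP[/eqP <-//|zp].
by rewrite -(ler_pM2r zp) -expr2.
Unshelve. all: by end_near.
Qed.

Lemma closure_orth (V : hilbertType R) (L : set V) (w z : V) :
  (forall x, L x -> ip x w = 0) -> closure L z -> ip z w = 0.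
Proof.
move=> h /closureP_seq[u Lu uz].
have h1 := cvg_ipl w uz; apply: (cvgR_unique h1).
by rewrite (_ : (fun n => _) = cst 0); [exact: cvg_cst|apply/funext => n /=; exact: h].
Qed.

(** Two vectors of the closure of [L] with the same inner products against [L]
    are equal. *)
Lemma closure_sub_eq (V : hilbertType R) (L : set V) (a b : V) : subspace L ->
  closure L a -> closure L b -> (forall x, L x -> ip x a = ip x b) -> a = b.
Proof.
move=> sL ha hb h; apply/eqP; rewrite -subr_eq0; apply/eqP/ip_eq0.
have {}h x : L x -> ip x (a - b) = 0 by move=> /h; rewrite !ipE => ->; rewrite subrr.
by rewrite ipDl ipNl (closure_orth h ha) (closure_orth h hb) subrr.
Qed.

Lemma projection (V : hilbertType R) (L : set V) : subspace L ->
  forall x, exists z, closure L z /\ forall y, L y -> ip y z = ip y x.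
Proof.
move=> sL x.
have [|a u v _ _||y _|z [h1 _ h2]] :=
  @riesz V V L id (fun y => ip y x) (nr x ^+ 2) sL.
- by [].
- by rewrite !ipE.
- exact: sqr_ge0.
- by rewrite -!ipuu mulrC; exact: ip_CS.
by exists z; split=> //; rewrite image_id in h1.
Qed.

Lemma dense_orth (V : hilbertType R) (L : set V) (w : V) : dense L ->
  (forall x, L x -> ip x w = 0) -> w = 0.
Proof.
move=> dL h; apply: ip_eq0; apply: closure_orth h _ => B.
rewrite nbhsE => -[O [oO Ow] OB].
have [y [Oy Ly]] : O `&` L !=set0 by apply: dL => //; exists w.
by exists y; split=> //; exact: OB.
Qed.

Lemma orth_dense (V : hilbertType R) (L : set V) : subspace L ->
  (forall w, (forall x, L x -> ip x w = 0) -> w = 0) -> dense L.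
Proof.
move=> sL h O [x Ox] oO.
have [z [Lz hz]] := projection sL x.
have /eqP : z - x = 0 by apply: h => y /hz; rewrite !ipE => ->; rewrite subrr.
rewrite subr_eq0 => /eqP zx; rewrite zx in Lz.
rewrite setIC; apply: Lz; exact: open_nbhs_nbhs.
Qed.
End Riesz.

(** * Bounded operators and their square roots *)

Section Bounded.
Variable R : realType.

Lemma ipZc (V : hilbertType R) (a : R[i]) (u v : V) :
  ip (a *: u) v = ip u (a^*%C *: v).
Proof.
case: a => x y; rewrite [x +i* y]complexE [_^*%C]complexE /= !scalerDl !ipDl !ipDr ipZl ipZr.
by rewrite ![_ * _%:C]mulrC -!scalerA ipZl ipZr ipii; ring.
Qed.

Lemma ip_ii (V : hilbertType R) (u v : V) : ip ('i *: u) ('i *: v) = ip u v.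
Proof. by rewrite ipii scalerA -expr2 sqr_i scaleN1r ipNr opprK. Qed.

Lemma cvgV_unique (V : hilbertType R) (u : nat -> V) (a b : V) :
  u @ \oo --> a -> u @ \oo --> b -> a = b.
Proof.
move=> ha hb; apply: ip_eq => w.
exact: (cvgR_unique (cvg_ipl w ha) (cvg_ipl w hb)).
Qed.

Lemma closure_subspace (V : hilbertType R) (L : set V) :
  subspace L -> subspace (closure L).
Proof.
move=> sL; split; first exact/subset_closure/(subspace0 sL).
move=> a x y /closureP_seq[u Lu ux] /closureP_seq[v Lv vy].
apply/closureP_seq; exists (fun n => a *: u n + v n) => [n|]; first exact: subspaceP.
by apply: cvgD => //; exact: cvgZr.
Qed.

Lemma image_subspace (V W : lmodType R[i]) (D : set V) (j : V -> W) :
  subspace D -> rlin_on D j -> subspace (j @` D).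
Proof.
move=> sD jl; split.
  by exists 0; [exact: subspace0|exact: (rlin0 sD jl)].
move=> a _ _ [x Dx <-] [y Dy <-]; exists (a *: x + y); first exact: subspaceP.
exact: jl.
Qed.

(** Factorization: when [t] is dominated by [j] on [D], there is a bounded [G]
    with [t = G^* j] on [D] and range in the closure of [j D]. *)
Lemma riesz_op (U : lmodType R[i]) (V W : hilbertType R) (D : set U)
    (j : U -> V) (t : U -> W) (c : R) :
  subspace D -> rlin_on D j -> rlin_on D t -> 0 <= c ->
  (forall x, D x -> nr (t x) ^+ 2 <= c * nr (j x) ^+ 2) ->
  exists G : W -> V, [/\ rlin_on setT G, forall k, nr (G k) ^+ 2 <= c * nr k ^+ 2,
    forall k, closure (j @` D) (G k)
    & forall k x, D x -> ip (j x) (G k) = ip (t x) k].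
Proof.
move=> sD jl tl c0 h.
have hG k : exists z : V, [/\ closure (j @` D) z, nr z ^+ 2 <= c * nr k ^+ 2 &
    forall x, D x -> ip (j x) z = ip (t x) k].
  apply: riesz => //; first by move=> a x y Dx Dy; rewrite tl// !ipE.
    by rewrite mulr_ge0// sqr_ge0.
  move=> x Dx; apply: le_trans (ip_CS _ _) _.
  by rewrite !ipuu [leRHS]mulrAC ler_wpM2r ?sqr_ge0 ?h.
have [G {}hG] := choice hG; exists G; split=> [a x y _ _|k|k|k x].
- have sL := image_subspace sD jl.
  apply: (closure_sub_eq sL); first by have [] := hG (a *: x + y).
    by apply: (subspaceP (closure_subspace sL)); have [] := hG x; have [] := hG y.
  move=> _ [v Dv <-]; have [_ _ ->//] := hG (a *: x + y).
  rewrite !ipDr -[a]conjcK -!ipZc.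
  have [_ _ <-//] := hG y; rewrite !ipZc conjcK -(conjcK a) -!ipZc; congr (_ + _).
  rewrite -(rlinZ sD tl _ Dv) -(rlinZ sD jl _ Dv).
  by have [_ _ ->//] := hG x; exact: subspaceZ.
- by have [] := hG k.
- by have [] := hG k.
- by have [_ _] := hG k; exact.
Qed.

(** The sesquilinear form [(F x, G y)] is hermitian as soon as it is nonnegative on
    the diagonal, because the scalars are complex. *)
Lemma nonneg_herm (V : lmodType R[i]) (W : hilbertType R) (D : set V)
    (F G : V -> W) : subspace D -> rlin_on D F -> rlin_on D G ->
  (forall x, D x -> 0 <= '[F x, G x]) ->
  forall x y, D x -> D y -> ip (F x) (G y) = ip (G x) (F y).
Proof.
move=> sD Fl Gl h x y Dx Dy.
have h0 u : D u -> ip ('i *: F u) (G u) = 0.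
  by move=> /h /ge0_ReP[+ _]; rewrite ip_i => ->; rewrite oppr0.
have h1 u v : D u -> D v -> ip ('i *: F u) (G v) + ip ('i *: F v) (G u) = 0.
  move=> Du Dv; have := h0 (u + v) (subspaceD sD Du Dv).
  by rewrite (rlinD Fl)// (rlinD Gl)// scalerDr !ipE h0// h0// add0r addr0.
have := h1 ('i *: x) y (subspaceZ sD _ Dx) Dy.
rewrite (rlinZ sD Fl)// (rlinZ sD Gl)// scalerA -expr2 sqr_i scaleN1r ip_ii !ipE (ipC (F y)) => e.
by apply/eqP; rewrite -subr_eq0 -oppr_eq0 opprB addrC e.
Qed.

Section Endo.
Variable V : hilbertType R.
Implicit Types (F C S : V -> V) (M : R).

(** Everywhere defined operators are plain functions: linear, bounded by [M],
    symmetric and nonnegative ones. *)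
Definition lin F := rlin_on setT F.
Definition bnd F M := forall x, nr (F x) <= M * nr x.
Definition sym F := forall x y, ip (F x) y = ip x (F y).
Definition pos F := forall x, 0 <= ip (F x) x.

Lemma subspaceT : subspace [set: V]. Proof. by []. Qed.
Lemma linP F a x y : lin F -> F (a *: x + y) = a *: F x + F y.
Proof. by move=> Fl; exact: Fl. Qed.
Lemma lin0 F : lin F -> F 0 = 0.
Proof. exact: rlin0 subspaceT. Qed.
Lemma linD F x y : lin F -> F (x + y) = F x + F y.
Proof. by move=> /rlinD; exact. Qed.
Lemma linZ F a x : lin F -> F (a *: x) = a *: F x.
Proof. by move=> /(rlinZ subspaceT); exact. Qed.
Lemma linN F x : lin F -> F (- x) = - F x.
Proof. by move=> Fl; rewrite -scaleN1r linZ// scaleN1r. Qed.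
Lemma linB F x y : lin F -> F (x - y) = F x - F y.
Proof. by move=> Fl; rewrite linD// linN. Qed.

Lemma sym_pos_inner F x : lin F -> sym F -> pos F -> 0 <= '[F x, x].
Proof.
move=> Fl Fs Fp; apply/ge0_ReP; split; last exact: Fp.
have : ip ('i *: F x) x = - ip ('i *: F x) x.
  by rewrite -{1}(linZ _ _ Fl) Fs [LHS]ipii ipC.
by rewrite ip_i; lra.
Qed.

(** From the Cauchy-Schwarz inequality for the form [(C x, y)], at [y = C x]. *)
Lemma pos_quad_bound C M : lin C -> sym C -> pos C -> bnd C M -> 0 <= M ->
  forall x, nr (C x) ^+ 2 <= M * ip (C x) x.
Proof.
move=> Cl Cs Cp CM M0 x.
have /discr_le : forall t : R,
    0 <= ip (C x) x * t ^+ 2 + 2 * (ip (C x) (C x) * t) + M * nr (C x) ^+ 2.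
  move=> t; have := Cp (t%:C *: x + C x); rewrite (linD _ _ Cl) (linZ _ _ Cl) !ipE (Cs (C x) x) => h.
  apply: le_trans h _.
  have : ip (C (C x)) (C x) <= M * nr (C x) ^+ 2.
    apply: le_trans (ler_norm _) _; apply: le_trans (ip_le _ _) _.
    by rewrite expr2 mulrA ler_wpM2r ?nr_ge0.
  by move: (ip _ _) (ip _ _) (ip _ _) => a b c; lra.
move=> /(_ (Cp x)); rewrite ipuu.
have [->|n0] := eqVneq (nr (C x)) 0; first by rewrite expr0n mulr_ge0.
have n1 : 0 < nr (C x) ^+ 2 by rewrite exprn_even_gt0.
by rewrite expr2 mulrA ler_pM2r// mulrC.
Qed.

(** The square root of a nonnegative contraction [C = 1 - D].  The iterates of
    [Y = (D + Y ^ 2) / 2] are polynomials in [D] with nonnegative coefficients, and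
    so are their increments.  As [D] is a contraction, an increment is bounded by the
    sum of its coefficients, and these sums are the increments of a nondecreasing
    real sequence bounded by 1.  The iterates therefore converge, and whatever
    commutes with [C] commutes with the limit. *)
Section Sqrt.
Variable C : V -> V.
Hypotheses (Cl : lin C) (Cs : sym C) (Cp : pos C) (C1 : bnd C 1).

Let D x := x - C x.

Lemma defect_contr x : nr (D x) <= nr x.
Proof.
rewrite -(ler_pXn2r (ltn0Sn 1)) ?nnegrE ?nr_ge0// -!ipuu /D !ipE (ipC x).
have := pos_quad_bound Cl Cs Cp C1 ler01 x; rewrite -ipuu; have := Cp x; lra.
Qed.

(** The polynomials in [D] with nonnegative coefficients, each with the sum of
    its coefficients. *)
Inductive cone : (V -> V) -> R -> Prop :=
| cone0 : cone (fun _ => 0) 0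
| cone1 : cone id 1
| coneS Z c of cone Z c : cone (fun x => D (Z x)) c
| coneA Z W c d of cone Z c & cone W d : cone (fun x => Z x + W x) (c + d)
| coneM a Z c of 0 <= a & cone Z c : cone (fun x => a%:C *: Z x) (a * c).

Lemma cone_ge0 Z c : cone Z c -> 0 <= c.
Proof. by elim=> // *; [exact: addr_ge0|exact: mulr_ge0]. Qed.

Lemma lin_defect : lin D.
Proof. by move=> a x y _ _; rewrite /D (linP _ _ _ Cl) scalerBr opprD addrACA. Qed.

Lemma cone_lin Z c : cone Z c -> lin Z.
Proof.
elim=> [||{}Z {}c _ Zl|{}Z W {}c d _ Zl _ Wl|a {}Z {}c _ _ Zl] b x y _ _ //.
- by rewrite scaler0 addr0.
- by rewrite (linP _ _ _ Zl) (linP _ _ _ lin_defect).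
- by rewrite (linP _ _ _ Zl) (linP _ _ _ Wl) scalerDr addrACA.
- by rewrite (linP _ _ _ Zl) scalerDr !scalerA mulrC.
Qed.

Lemma cone_bnd Z c : cone Z c -> bnd Z c.
Proof.
elim=> [||{}Z {}c _ Zb|{}Z W {}c d _ Zb _ Wb|a {}Z {}c a0 _ Zb] x.
- by rewrite nr0 mul0r.
- by rewrite mul1r.
- exact: le_trans (defect_contr _) _.
- by apply: le_trans (nrD _ _) _; rewrite mulrDl lerD.
- by rewrite nrZ ger0_norm// -mulrA ler_wpM2l.
Qed.

Lemma cone_comm F Z c : lin F -> (forall x, F (C x) = C (F x)) -> cone Z c ->
  forall x, F (Z x) = Z (F x).
Proof.
move=> Fl FC; elim=> [||{}Z {}c _ h|{}Z W {}c d _ h _ h'|a {}Z {}c _ _ h] x //.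
- exact: lin0.
- by rewrite (linB _ _ Fl) FC h.
- by rewrite (linD _ _ Fl) h h'.
- by rewrite (linZ _ _ Fl) h.
Qed.

Lemma cone_sym Z c : cone Z c -> sym Z.
Proof.
elim=> [||{}Z {}c hZ Zs|{}Z W {}c d _ Zs _ Ws|a {}Z {}c _ _ Zs] x y //.
- by rewrite ip0l ip0r.
- have DC z : D (C z) = C (D z) by rewrite /D (linB _ _ Cl).
  by rewrite [in RHS](cone_comm lin_defect DC hZ) -Zs /D !ipE Cs.
- by rewrite !ipE Zs Ws.
- by rewrite !ipE Zs.
Qed.

Lemma cone_comp Z W c d : cone Z c -> cone W d -> cone (fun x => Z (W x)) (c * d).
Proof.
move=> hZ hW; elim: hZ => [||{}Z {}c _ h|{}Z Z' {}c c' _ h _ h'|a {}Z {}c a0 _ h].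
- by rewrite mul0r; exact: cone0.
- by rewrite mul1r; exact: hW.
- exact: (coneS h).
- by rewrite mulrDl; exact: (coneA h h').
- by rewrite -mulrA; exact: (coneM a0 h).
Qed.

(** The iterates, and the sums of their coefficients. *)
Fixpoint sqY n x := if n is n'.+1 then (2^-1 : R)%:C *: (D x + sqY n' (sqY n' x)) else 0.
Fixpoint sqy n : R := if n is n'.+1 then 2^-1 * (1 + sqy n' * sqy n') else 0.

Lemma half_ge0 : 0 <= 2^-1 :> R. Proof. by rewrite invr_ge0 ler0n. Qed.

Lemma sqY_cone n : cone (sqY n) (sqy n).
Proof.
elim: n => [|n IH]; first exact: cone0.
exact: (coneM half_ge0 (coneA (coneS cone1) (cone_comp IH IH))).
Qed.

Lemma sqY_step n : exists2 Z, cone Z (sqy n.+1 - sqy n) &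
  forall x, sqY n.+1 x = sqY n x + Z x.
Proof.
elim: n => [|n [Z hZ ZE]].
  by exists (sqY 1); [rewrite subr0; exact: sqY_cone|move=> x; rewrite /= add0r].
have hY := sqY_cone n; have Yl := cone_lin hY; have Zl := cone_lin hZ.
exists (fun x => (2^-1 : R)%:C *: (sqY n (Z x) + (Z (sqY n x) + Z (Z x)))).
  have := coneM half_ge0 (coneA (cone_comp hY hZ) (coneA (cone_comp hZ hY) (cone_comp hZ hZ))).
  by congr cone; rewrite /=; field.
move=> x; have e : sqY n.+1 (sqY n.+1 x) =
    sqY n (sqY n x) + (sqY n (Z x) + (Z (sqY n x) + Z (Z x))).
  by rewrite (ZE x) ZE (linD _ _ Yl) (linD _ _ Zl) -!addrA.
transitivity ((2^-1 : R)%:C *: (D x + sqY n.+1 (sqY n.+1 x))) => //.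
by rewrite e addrA scalerDr.
Qed.

Lemma sqy_le1 n : sqy n <= 1.
Proof.
elim: n => [|n IH] //=; have := cone_ge0 (sqY_cone n).
move: (sqy n) IH => y y1 y0; nra.
Qed.

Lemma sqy_homo : {homo sqy : n m / (n <= m)%N >-> n <= m}.
Proof.
apply: homo_leq => // [y x z|n]; first exact: le_trans.
by have [Z /cone_ge0] := sqY_step n; rewrite subr_ge0.
Qed.

Lemma sqY_dist n k x : nr (sqY (n + k) x - sqY n x) <= (sqy (n + k) - sqy n) * nr x.
Proof.
elim: k => [|k IH]; first by rewrite addn0 !subrr nr0 mul0r.
have [Z hZ ZE] := sqY_step (n + k); rewrite addnS ZE addrAC.
apply: le_trans (nrD _ _) _; apply: le_trans (lerD IH (cone_bnd hZ x)) _.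
by rewrite -mulrDl addrC addrA subrK.
Qed.

Lemma sqY_cvg x : exists y : V, (fun n => sqY n x) @ \oo --> y.
Proof.
have /cvg_ex[l /= /cvg_RP hl] : cvgn sqy.
  apply: nondecreasing_is_cvgn; first exact: sqy_homo.
  by exists 1 => _ [n _ <-]; exact: sqy_le1.
have nx : 0 < nr x + 1 by have := nr_ge0 x; lra.
apply: nr_complete => e e0; have e1 : 0 < e / (nr x + 1) / 2 by rewrite !divr_gt0.
have [N hN] := hl _ e1; exists N.
suff h n m : (N <= n)%N -> (n <= m)%N -> nr (sqY m x - sqY n x) < e.
  by move=> n m Nn Nm; case/orP: (leq_total n m) => ?; [rewrite nrB|]; apply: h.
move=> Nn nm; have hn := hN n Nn; have hm := hN m (leq_trans Nn nm).
have := sqY_dist n (m - n) x; rewrite subnKC// => h; apply: le_lt_trans h _.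
apply: (@le_lt_trans _ _ ((sqy m - sqy n) * (nr x + 1))).
  by rewrite ler_wpM2l ?subr_ge0 ?sqy_homo//; lra.
rewrite -ltr_pdivlMr//; have := ler_norm (sqy m - l); have := ler_norm (l - sqy n).
rewrite distrC in hn; lra.
Qed.

Lemma sqrt_contr : exists S, [/\ lin S, sym S, pos S, forall x, S (S x) = C x &
  forall F M, lin F -> bnd F M -> (forall x, F (C x) = C (F x)) ->
    forall x, F (S x) = S (F x)].
Proof.
have [Y hY] := choice sqY_cvg.
have Yl : lin Y.
  move=> a x y _ _; apply: (cvgV_unique (hY _)).
  rewrite (_ : (fun n => _) = (fun n => a *: sqY n x + sqY n y)).
    by apply: cvgD => //; exact: cvgZr.
  by apply/funext => n; rewrite (linP _ _ _ (cone_lin (sqY_cone n))).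
have Y1 x : ip (Y x) x <= ip x x.
  apply: (ler_cvg_to (cvg_ipl x (hY x)) (cvg_cst (ip x x))).
  near=> n; apply: le_trans (ler_norm _) _; apply: le_trans (ip_le _ _) _.
  rewrite ipuu expr2 ler_wpM2r ?nr_ge0//; apply: le_trans (cone_bnd (sqY_cone n) x) _.
  by rewrite ler_piMl ?nr_ge0// sqy_le1.
have Ys : sym Y.
  move=> x y; apply: (cvgR_unique (cvg_ipl y (hY x))).
  rewrite (_ : (fun n => _) = (fun n => ip x (sqY n y))); first exact: cvg_ipr.
  by apply/funext => n; rewrite (cone_sym (sqY_cone n)).
have YY x : (2^-1 : R)%:C *: (D x + Y (Y x)) = Y x.
  apply: (@cvgV_unique _ (fun n => sqY n.+1 x)); last first.
    by have := hY x; rewrite -(cvg_shiftS (fun n => sqY n x)).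
  apply: cvgZr; apply: cvgD; first exact: cvg_cst.
  apply/cvg_nrP => e e0; have e2 : 0 < e / 2 by lra.
  have [N hN] := (cvg_nrP _ _).1 (hY x) _ e2.
  have [N' hN'] := (cvg_nrP _ _).1 (hY (Y x)) _ e2.
  exists (maxn N N') => n; rewrite geq_max => /andP[/hN h1 /hN' h2].
  rewrite -/(sqY n (sqY n x)).
  have -> : sqY n (sqY n x) - Y (Y x) =
      (sqY n (sqY n x) - sqY n (Y x)) + (sqY n (Y x) - Y (Y x)).
    by rewrite addrA subrK.
  apply: le_lt_trans (nrD _ _) _; rewrite -(linB _ _ (cone_lin (sqY_cone n))).
  have : nr (sqY n (sqY n x - Y x)) <= nr (sqY n x - Y x).
    apply: le_trans (cone_bnd (sqY_cone n) _) _.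
    by rewrite ler_piMl ?nr_ge0// sqy_le1.
  lra.
exists (fun x => x - Y x); split.
- by move=> a x y _ _; rewrite (linP _ _ _ Yl) scalerBr opprD addrACA.
- by move=> x y; rewrite !ipE Ys.
- by move=> x; rewrite !ipE; have := Y1 x; lra.
- move=> x; rewrite (linB _ _ Yl); have := YY x.
  move=> /(congr1 (fun z => (2 : R)%:C *: z)); rewrite scalerA -rmorphM mulfV ?pnatr_eq0//.
  rewrite scale1r (_ : (2 : R)%:C = 1 + 1); last by rewrite -[1 in RHS](rmorph1 (real_complex R)) -rmorphD.
  rewrite scalerDl scale1r /D => e.
  have -> : x - Y x - (Y x - Y (Y x)) = (x + Y (Y x)) - (Y x + Y x).
    by rewrite opprB addrACA opprD.
  by rewrite -e opprD addrACA subrr addr0 opprB addrC subrK.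
- move=> F M Fl FM FC x; rewrite (linB _ _ Fl); congr (_ - _).
  have FB u v : F (u - v) = F u - F v by rewrite (linB _ _ Fl).
  apply: (cvgV_unique (cvg_bounded FB FM (hY x))).
  rewrite (_ : (fun n => _) = (fun n => sqY n (F x))); first exact: hY.
  by apply/funext => n; exact: (cone_comm Fl FC (sqY_cone n)).
Unshelve. all: by end_near.
Qed.
End Sqrt.

Lemma sqrt_bounded C M : lin C -> sym C -> pos C -> bnd C M ->
  exists S, [/\ lin S, sym S, pos S & forall x, S (S x) = C x].
Proof.
move=> Cl Cs Cp CM; pose m := `|M| + 1.
have m0 : 0 < m by rewrite /m; have := normr_ge0 M; lra.
pose C' x := (m^-1)%:C *: C x.
have mV : 0 <= m^-1 by rewrite invr_ge0 ltW.
have [||||S [Sl Ss Sp SS _]] := @sqrt_contr C'.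
- by move=> a x y _ _; rewrite /C' (linP _ _ _ Cl) scalerDr !scalerA mulrC.
- by move=> x y; rewrite /C' !ipE Cs.
- by move=> x; rewrite /C' !ipE mulr_ge0.
- move=> x; rewrite /C' nrZ ger0_norm// ler_pdivrMl// mul1r.
  apply: le_trans (CM x) _; rewrite ler_wpM2r ?nr_ge0// /m.
  have := ler_norm M; lra.
exists (fun x => (Num.sqrt m)%:C *: S x); split.
- by move=> a x y _ _; rewrite (linP _ _ _ Sl) scalerDr !scalerA mulrC.
- by move=> x y; rewrite !ipE Ss.
- by move=> x; rewrite !ipE mulr_ge0// sqrtr_ge0.
- move=> x; rewrite (linZ _ _ Sl) SS /C' !scalerA -!rmorphM -expr2 sqr_sqrtr ?ltW//.
  by rewrite mulfV ?gt_eqF// scale1r.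
Qed.
End Endo.
End Bounded.

(** * Graphs of unbounded operators *)

Section Graphs.
Variable R : realType.

Section Two.
Variables H K : hilbertType R.
Implicit Types A : set (H * K).

Lemma lin_subspace A : linear_operator A -> subspace A.
Proof. by case=> h0 hl _; split=> // a p q; exact: hl. Qed.

Lemma lin_fun A f k k' : linear_operator A -> A (f, k) -> A (f, k') -> k = k'.
Proof. by case=> _ _; exact. Qed.

Lemma apP A f : dom A f -> A (f, ap A f).
Proof. by case=> k Ak; apply: (@xgetPex _ 0 [set k | A (f, k)]); exists k. Qed.

Lemma apE A f k : linear_operator A -> A (f, k) -> ap A f = k.
Proof. by move=> Al Ak; apply: (lin_fun Al _ Ak); apply: apP; exists k. Qed.

Lemma dom_subspace A : linear_operator A -> subspace (dom A).
Proof.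
move=> Al; have sA := lin_subspace Al; split; first by exists 0; exact: subspace0 sA.
move=> a x y /apP hx /apP hy; exists (a *: ap A x + ap A y).
exact: (subspaceP sA a hx hy).
Qed.

Lemma ap_lin A : linear_operator A -> rlin_on (dom A) (ap A).
Proof.
move=> Al a x y /apP hx /apP hy; apply: apE => //.
exact: (subspaceP (lin_subspace Al) a hx hy).
Qed.

Lemma adjointP A k h : linear_operator A ->
  adjoint A (k, h) <-> forall f l, A (f, l) -> ip l k = ip f h.
Proof.
move=> Al; split=> [h1 f l /h1 /= e|h1 f l Al' /=]; first by rewrite /ip e.
apply: complexify; first exact: h1.
apply: h1; exact: (subspaceZ (lin_subspace Al) 'i Al').
Qed.

Lemma adjoint_closed A : linear_operator A -> closed (adjoint A).
Proof.
move=> Al [k h] /closure_pairP[u [v [uv uk vh]]]; apply/adjointP => // f l fl.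
apply: (cvgR_unique (cvg_ipr l uk)).
rewrite (_ : (fun n => _) = (fun n => ip f (v n))); first exact: cvg_ipr.
by apply/funext => n; have /adjointP := uv n; exact.
Qed.

(** The orthogonal projection of [(h, l)] onto a closed graph. *)
Lemma graph_projection A h l : linear_operator A -> closed A ->
  exists f k, A (f, k) /\ forall g m, A (g, m) -> ip g (h - f) + ip m (l - k) = 0.
Proof.
move=> Al cA; have sA := lin_subspace Al.
pose p (x y : H * K) := ip x.1 y.1 + ip x.2 y.2.
pose phi (x : H * K) := ip x.1 h + ip x.2 l.
have psym x y : A x -> A y -> p x y = p y x by rewrite /p !(ipC y.1, ipC y.2).
have plin (a : R) x y z : A x -> A y -> A z -> p (a%:C *: x + y) z = a * p x z + p y z.
  by move=> _ _ _; rewrite /p /= !ipE; ring.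
have p0 x : A x -> 0 <= p x x by move=> _; rewrite addr_ge0// ip_ge0.
have phil (a : R) x y : A x -> A y -> phi (a%:C *: x + y) = a * phi x + phi y.
  by move=> _ _; rewrite /phi /= !ipE; ring.
pose c := ip h h + ip l l; have c0 : 0 <= c by rewrite addr_ge0// ip_ge0.
have phic x : A x -> phi x ^+ 2 <= c * p x x.
  move=> Ax; rewrite mulrC; apply: discr_le => [|t]; first exact: p0.
  suff -> : p x x * t ^+ 2 + 2 * (phi x * t) + c =
    ip (t%:C *: x.1 + h) (t%:C *: x.1 + h) + ip (t%:C *: x.2 + l) (t%:C *: x.2 + l).
    by rewrite addr_ge0// ip_ge0.
  by rewrite /p /phi /c !ipE (ipC h x.1) (ipC l x.2); ring.
have [u hu] := riesz_approx sA psym plin p0 phil c0 phic.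
have Au n : A (u n) by have [] := hu n.
have hc := riesz_cauchy sA psym plin p0 hu.
have [f uf] : exists f : H, (fun n => (u n).1) @ \oo --> f.
  apply: nr_complete => e e0; have [N hN] := hc _ (exprn_gt0 2 e0).
  exists N => n m Nn Nm; rewrite -(ltr_pXn2r (ltn0Sn 1)) ?nnegrE ?nr_ge0 ?(ltW e0)//.
  apply: le_lt_trans (hN n m Nn Nm); rewrite /p -ipuu /= lerDl; exact: ip_ge0.
have [k uk] : exists k : K, (fun n => (u n).2) @ \oo --> k.
  apply: nr_complete => e e0; have [N hN] := hc _ (exprn_gt0 2 e0).
  exists N => n m Nn Nm; rewrite -(ltr_pXn2r (ltn0Sn 1)) ?nnegrE ?nr_ge0 ?(ltW e0)//.
  apply: le_lt_trans (hN n m Nn Nm); rewrite /p -ipuu /= lerDr; exact: ip_ge0.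
exists f, k; split.
  by apply: (closed_pair cA _ uf uk) => n; case: (u n) (Au n).
move=> g m gm; have h1 : (fun n => p (g, m) (u n)) @ \oo --> p (g, m) (f, k).
  by apply: cvgD; exact: cvg_ipr.
suff : p (g, m) (f, k) = phi (g, m) by rewrite /p /phi /= !ipE => e; lra.
apply: (cvgR_unique h1); apply/cvg_RP => e e0.
have P0 := p0 _ gm; have P1 : 0 < p (g, m) (g, m) + 1 by lra.
have [N hN] := inv_succ_small (divr_gt0 (exprn_gt0 2 e0) P1).
exists N => n /hN hn; have [_ /(_ _ gm) kn] := hu n.
rewrite -(ltr_pXn2r (ltn0Sn 1)) ?nnegrE ?normr_ge0 ?(ltW e0)//.
rewrite real_normK ?num_real//; apply: le_lt_trans kn _.
move: hn; rewrite ltr_pdivlMr//; have := inv_succ_gt0 R n; lra.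
Qed.

End Two.

Section Param.
Variable H : hilbertType R.
Implicit Types P Q C : H -> H.

(** The relation sending [P u] to [Q u], that is [Q P^-1] when [P] is injective. *)
Definition param_op P Q : set (H * H) := [set x | exists u, x = (P u, Q u)].

Lemma param_linear P Q : lin P -> lin Q -> (forall u, P u = 0 -> u = 0) ->
  linear_operator (param_op P Q).
Proof.
move=> Pl Ql Pi; split.
- by exists 0; rewrite !lin0.
- by move=> a _ _ [u ->] [v ->]; exists (a *: u + v); rewrite (linP _ _ _ Pl) (linP _ _ _ Ql).
- move=> f k k' [u [-> ->]] [v [e ->]]; congr Q; apply/eqP; rewrite -subr_eq0.
  by apply/eqP/Pi; rewrite (linB _ _ Pl) e subrr.
Qed.

(** The hypothesis on the solutions of [Q f = P h] says that the graph is as large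
    as symmetry permits. *)
Lemma param_selfadjoint P Q : lin P -> lin Q -> sym P -> sym Q ->
  (forall u, P u = 0 -> u = 0) -> (forall u, P (Q u) = Q (P u)) ->
  (forall f h, Q f = P h -> exists2 u, f = P u & h = Q u) ->
  selfadjoint (param_op P Q).
Proof.
move=> Pl Ql Ps Qs Pi PQ hPQ; have Al := param_linear Pl Ql Pi; split => //.
  apply: orth_dense; first exact: dom_subspace.
  move=> w hw; apply: Pi; apply: ip_eq0; rewrite Ps ipC; apply: hw.
  by exists (Q (P w)), (P w).
apply/seteqP; split=> -[f h].
  move/(adjointP _ _ Al) => fh; have [|u -> ->] := hPQ f h; last by exists u.
  by apply: ip_eq => u; rewrite ipC -Qs (fh (P u)) ?Ps 1?ipC//; exists u.
move=> [u [-> ->]]; apply/adjointP => // _ _ [v [-> ->]].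
by rewrite Qs Ps -PQ.
Qed.

(** The product of commuting nonnegative contractions is nonnegative. *)
Lemma pos_comm P Q : lin P -> sym P -> pos P -> bnd P 1 ->
  lin Q -> sym Q -> pos Q -> bnd Q 1 -> (forall u, P (Q u) = Q (P u)) ->
  forall u, 0 <= ip (P (Q u)) u.
Proof.
move=> Pl Ps Pp P1 Ql Qs Qp Q1 PQ u.
have [S [Sl Ss Sp SS SF]] := sqrt_contr Pl Ps Pp P1.
by rewrite -SS Ss -(SF Q 1).
Qed.

Lemma sqrt_bnd1 C S : sym S -> (forall x, S (S x) = C x) -> bnd C 1 -> bnd S 1.
Proof.
move=> Ss SS C1 x; rewrite mul1r -(ler_pXn2r (ltn0Sn 1)) ?nnegrE ?nr_ge0//.
rewrite -ipuu -Ss SS; apply: le_trans (ler_norm _) _; apply: le_trans (ip_le _ _) _.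
by rewrite expr2 ler_wpM2r ?nr_ge0//; have := C1 x; rewrite mul1r.
Qed.

(** [N] is [C^-1 - 1], so that [C = (1 + N)^-1], and [Q P^-1] is a square root of
    [N], with [P] and [Q] the square roots of [C] and [1 - C]. *)
Lemma resolvent_sqrt C : lin C -> sym C -> pos C -> bnd C 1 ->
  (forall u, C u = 0 -> u = 0) ->
  let N := param_op C (fun u => u - C u) in
  [/\ selfadjoint N, nonneg_op N &
    exists S, [/\ selfadjoint S, nonneg_op S & op_comp S S = N]].
Proof.
move=> Cl Cs Cp C1 Ci N.
have Dl : lin (fun u => u - C u) := lin_defect Cl.
have Ds : sym (fun u => u - C u) by move=> x y; rewrite !ipE Cs.
have Dp : pos (fun u => u - C u).
  move=> x; rewrite !ipE subr_ge0; apply: le_trans (ler_norm _) _.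
  apply: le_trans (ip_le _ _) _; rewrite ipuu expr2 ler_wpM2r ?nr_ge0//.
  by have := C1 x; rewrite mul1r.
have D1 : bnd (fun u => u - C u) 1 by move=> x; rewrite mul1r; exact: defect_contr.
have Nl : linear_operator N by exact: param_linear.
have nonneg P Q : lin P -> lin Q -> sym P -> sym Q -> (forall u, P u = 0 -> u = 0) ->
    (forall u, P (Q u) = Q (P u)) -> pos (fun u => P (Q u)) -> nonneg_op (param_op P Q).
  move=> Pl Ql Ps Qs Pi PQ PQp f [_ [u [-> _]]].
  have -> : ap (param_op P Q) (P u) = Q u by apply: apE; [exact: param_linear|exists u].
  have -> : '[Q u, P u] = '[P (Q u), u].
    by apply: complexify; rewrite -Ps// (linZ _ _ Pl).
  apply: (sym_pos_inner (F := fun u => P (Q u))) => //.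
    by move=> a x y _ _; rewrite (linP _ _ _ Ql) (linP _ _ _ Pl).
  by move=> x y; rewrite Ps Qs -PQ.
have CD u : C (u - C u) = C u - C (C u) by rewrite (linB _ _ Cl).
split.
- apply: param_selfadjoint => // f h /eqP; rewrite subr_eq -(linD _ _ Cl) => /eqP e.
  by exists (h + f); rewrite // -e addrK.
- by apply: nonneg => //; exact: (pos_comm Cl Cs Cp C1 Dl Ds Dp D1 CD).
have [P [Pl Ps Pp PP PF]] := sqrt_contr Cl Cs Cp C1.
have [Q [Ql Qs Qp QQ QF]] := sqrt_contr Dl Ds Dp D1.
have P1 := sqrt_bnd1 Ps PP C1; have Q1 := sqrt_bnd1 Qs QQ D1.
have PQ u : P (Q u) = Q (P u).
  by apply: (QF P 1) => // x; rewrite (linB _ _ Pl) -!PP.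
have Pi u : P u = 0 -> u = 0 by move=> Pu; apply: Ci; rewrite -PP Pu lin0.
have PPQQ u : P (P u) + Q (Q u) = u by rewrite PP QQ addrC subrK.
exists (param_op P Q); split.
(* If Q f = P h, then u = P f + Q h has P u = f and Q u = h, as P^2 + Q^2 = 1. *)
- apply: param_selfadjoint => // f h e; exists (P f + Q h).
    by rewrite (linD _ _ Pl) PQ -e PPQQ.
  by rewrite (linD _ _ Ql) -PQ e PPQQ.
- by apply: nonneg => //; exact: (pos_comm Pl Ps Pp P1 Ql Qs Qp Q1 PQ).
apply/seteqP; split=> -[f h].
  move=> [k [[u [/= -> ->]] [v [e ->]]]]; exists (P u + Q v).
  congr pair.
    by rewrite -PP (linD _ _ Pl) PQ -e -{1}(PPQQ u) !(linD _ _ Pl) PQ.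
  by rewrite -QQ (linD _ _ Ql) -PQ e -{1}(PPQQ v) !(linD _ _ Ql) -PQ.
move=> [w [-> ->]]; exists (P (Q w)); split => /=.
  by exists (P w); rewrite PP PQ.
by exists (Q w); rewrite QQ.
Qed.

End Param.
End Graphs.

(** * The operator A^* A and its square root *)

Section VonNeumann.
Variable R : realType.

Section One.
Variables (H K : hilbertType R) (A : set (H * K)).
Hypotheses (Al : linear_operator A) (Ac : closed A) (Ad : densely_defined A).

Local Notation N := (op_comp (adjoint A) A).

Lemma mul_adjoint_quad g h k : A (g, k) -> adjoint A (k, h) -> ip h g = nr k ^+ 2.
Proof. by move=> gk /(adjointP _ _ Al)/(_ _ _ gk); rewrite ipuu ipC. Qed.

(** [1 + A^* A] is onto, and its inverse is a nonnegative contraction [C]: the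
    pair [(C h, A C h)] is the projection of [(h, 0)] onto the graph of [A]. *)
Lemma mul_adjoint_resolvent : exists C : H -> H,
  [/\ [/\ lin C, sym C, pos C & bnd C 1], forall u, C u = 0 -> u = 0 &
    N = param_op C (fun u => u - C u)].
Proof.
have sA := lin_subspace Al.
have h1 h : exists fk : H * K, A fk /\ adjoint A (fk.2, h - fk.1).
  have [f [k [fk fkP]]] := graph_projection h 0 Al Ac.
  exists (f, k); split=> //; apply/adjointP => // g m gm.
  by have := fkP g m gm; rewrite sub0r ipNr => /eqP; rewrite subr_eq0 => /eqP.
have [CA hCA] := choice h1; pose C h := (CA h).1; pose E h := (CA h).2.
have AC h : A (C h, E h) by have [] := hCA h; rewrite /C /E; case: (CA h).
have EC h : adjoint A (E h, h - C h) by have [] := hCA h.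
have EP h g m : A (g, m) -> ip m (E h) = ip g (h - C h).
  by move=> gm; have /adjointP := EC h; apply.
have uniq f k h : A (f, k) -> adjoint A (k, h - f) -> f = C h.
  move=> fk kh; have d : A (f - C h, k - E h) by exact: (subspaceB sA fk (AC h)).
  have h2 := EP h _ _ d; have /adjointP := kh => /(_ Al _ _ d) h3.
  apply/eqP; rewrite -subr_eq0; apply/eqP/ip_eq0.
  have : ip (k - E h) (k - E h) = - ip (f - C h) (f - C h).
    have gen w : ip w (h - f) - ip w (h - C h) = - ip w (f - C h).
      by rewrite !ipDr !ipNr; lra.
    by rewrite -gen -h2 -h3 -ipNr -ipDr.
  have := ip_ge0 (k - E h); have := ip_ge0 (f - C h); lra.
have Cl : lin C.
  move=> a x y _ _; symmetry.
  apply: (uniq _ (a *: E x + E y)); first exact: (subspaceP sA a (AC x) (AC y)).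
  apply/adjointP => // g m gm.
  have gam := subspaceZ sA (a^*)%C gm.
  rewrite !ipDr -[a]conjcK -!ipZc (EP x _ _ gam) (EP y _ _ gm) !ipZc conjcK.
  by rewrite scalerBr opprD !ipDr; lra.
have CE x y : ip (C x) y = ip (C x) (C y) + ip (E x) (E y).
  by rewrite (EP y _ _ (AC x)) !ipE; lra.
have Ci u : C u = 0 -> u = 0.
  move=> Cu0; apply: (dense_orth Ad) => f [k fk].
  have := EP u _ _ fk; rewrite Cu0 subr0 => <-.
  have := AC u; rewrite Cu0 => e; rewrite (lin_fun Al e (subspace0 sA)) ip0r //.
exists C; split=> //.
- split=> // [x y|x|x]; first by rewrite CE (ipC (C x)) (ipC (E x)) -CE ipC.
    by rewrite CE addr_ge0// ip_ge0.
  rewrite mul1r; have : nr (C x) ^+ 2 <= nr (C x) * nr x.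
    apply: le_trans (le_trans (ler_norm _) (ip_le (C x) x)).
    by rewrite CE -ipuu lerDl ip_ge0.
  have := nr_ge0 (C x); rewrite le_eqVlt => /orP[/eqP <- _|c0]; first exact: nr_ge0.
  by rewrite expr2 ler_pM2l.
- apply/seteqP; split=> -[f h].
    move=> [k [/= fk kh]]; exists (f + h).
    have e : f = C (f + h) by apply: (uniq _ k) => //; rewrite addrC addKr.
    by rewrite -e addrC addKr.
  by move=> [u [-> ->]]; exists (E u); split; [exact: AC|exact: EC].
Qed.

Lemma mul_adjoint_selfadjoint : [/\ selfadjoint N, nonneg_op N &
  exists S, [/\ selfadjoint S, nonneg_op S & op_comp S S = N]].
Proof.
have [C [[Cl Cs Cp C1] Ci ->]] := mul_adjoint_resolvent.
exact: resolvent_sqrt.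
Qed.

(** The domain of [A], and the norm of [A f], are determined by the values of
    [A^* A], because the domain of [A^* A] is a core of [A].  The candidate [z] for
    [A f] represents the functional [A g |-> (f, A^* A g)]; the component of
    [(f, z)] orthogonal to the graph of [A] vanishes since [1 + A^* A] is onto. *)
Lemma core_char (f : H) (c : R) : 0 <= c ->
  (forall g h, N (g, h) -> ip f h ^+ 2 <= c * ip h g) ->
  exists2 k, A (f, k) & nr k ^+ 2 <= c.
Proof.
move=> c0 hf; have sA := lin_subspace Al.
have [[Nl _ _] _ _] := mul_adjoint_selfadjoint.
have NA g : dom N g -> dom A g by move=> [h [k [/= gk _]]]; exists k.
have [|||||z [zcl zc hz]] := @riesz R H K (dom N) (ap A) (fun g => ip f (ap N g)) c.
- exact: dom_subspace.
- by move=> a x y Dx Dy; rewrite (ap_lin Al)//; exact: NA.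
- by move=> a x y Dx Dy; rewrite (ap_lin Nl)// !ipE.
- by [].
- move=> g Dg; have /= gh := apP Dg; apply: le_trans (hf _ _ gh) _.
  have [k [/= gk kh]] := gh; rewrite (mul_adjoint_quad gk kh).
  by rewrite (apE Al gk).
have [f' [z' [fz' hp]]] := graph_projection f z Al Ac.
set a := f - f' in hp; set b := z - z' in hp.
have a0 : a = 0.
  have [C [_ _ NE]] := mul_adjoint_resolvent.
  have : N (C a, a - C a) by rewrite NE; exists a.
  move: (C a) (a - C a) (subrK (C a) a) => g h e gh.
  have [k [/= gk kh]] := gh; apply: ip_eq0; rewrite -{1}e.
  have h1 := hp _ _ gk.
  have h2 : ip k z = ip f h by rewrite -(apE Al gk) hz ?(apE Nl gh)//; exists h.
  have h3 : ip z' k = ip f' h by have /adjointP := kh; apply.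
  have h4 : ip k b = ip a h by rewrite /b /a !ipE h2 (ipC k) h3.
  by rewrite ipDl -h1 h4 addrC (ipC h).
have b0 : b = 0.
  have hb x : (ap A @` dom N) x -> ip x b = 0.
    move=> [g /NA/apP gm <-]; have := hp _ _ gm; by rewrite a0 ip0r add0r.
  apply: ip_eq0; rewrite {1}/b ipDl ipNl (closure_orth hb zcl).
  by have := hp _ _ fz'; rewrite a0 ip0r add0r => ->; rewrite subrr.
exists z => //; move/eqP: a0; rewrite subr_eq0 => /eqP ->.
by move/eqP: b0; rewrite subr_eq0 => /eqP ->.
Qed.

End One.

Lemma mul_adjoint_le (H K1 K2 : hilbertType R) (A1 : set (H * K1)) (A2 : set (H * K2)) :
  linear_operator A1 -> linear_operator A2 -> closed A2 -> densely_defined A2 ->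
  op_comp (adjoint A1) A1 = op_comp (adjoint A2) A2 ->
  forall f k, A1 (f, k) -> exists2 k', A2 (f, k') & nr k' <= nr k.
Proof.
move=> l1 l2 c2 d2 e f k fk.
have [|g h gh|k' fk' kk'] := core_char l2 c2 d2 (f := f) (c := nr k ^+ 2).
- exact: sqr_ge0.
- move: gh; rewrite -e => -[m [/= gm mh]].
  rewrite (mul_adjoint_quad l1 gm mh); have /adjointP := mh => /(_ l1 _ _ fk) <-.
  by rewrite -!ipuu; exact: ip_CS.
by exists k' => //; rewrite -(ler_pXn2r (ltn0Sn 1)) ?nnegrE ?nr_ge0.
Qed.

Lemma polarize (V : lmodType R[i]) (W W' : hilbertType R) (D : set V)
    (F : V -> W) (G : V -> W') : subspace D -> rlin_on D F -> rlin_on D G ->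
  (forall x, D x -> nr (F x) = nr (G x)) ->
  forall x y, D x -> D y -> '[F x, F y] = '[G x, G y].
Proof.
move=> sD Fl Gl h.
have h1 x y : D x -> D y -> ip (F x) (F y) = ip (G x) (G y).
  move=> Dx Dy; have := h _ (subspaceD sD Dx Dy).
  move=> /(congr1 (fun r => r ^+ 2)); rewrite -!ipuu (rlinD Fl)// (rlinD Gl)// !ipE.
  by rewrite !ipuu !h// (ipC (F y)) (ipC (G y)); lra.
move=> x y Dx Dy; apply: complexify; first exact: h1.
rewrite -(rlinZ sD Fl _ Dx) -(rlinZ sD Gl _ Dx); apply: h1 => //; exact: subspaceZ.
Qed.

(** Consequently [A1^* A1 = A2^* A2] forces equal domains and equal forms, even
    for operators into different spaces. *)
Lemma mul_adjoint_eq (H K1 K2 : hilbertType R) (A1 : set (H * K1)) (A2 : set (H * K2)) :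
  linear_operator A1 -> closed A1 -> densely_defined A1 ->
  linear_operator A2 -> closed A2 -> densely_defined A2 ->
  op_comp (adjoint A1) A1 = op_comp (adjoint A2) A2 ->
  dom A1 = dom A2 /\
  forall f g, dom A1 f -> dom A1 g -> '[ap A1 f, ap A1 g] = '[ap A2 f, ap A2 g].
Proof.
move=> l1 c1 d1 l2 c2 d2 e.
have h1 := mul_adjoint_le l1 l2 c2 d2 e.
have h2 := mul_adjoint_le l2 l1 c1 d1 (esym e).
have ed : dom A1 = dom A2.
  apply/seteqP; split=> f [k fk]; first by have [k' ? _] := h1 _ _ fk; exists k'.
  by have [k' ? _] := h2 _ _ fk; exists k'.
split=> //; apply: polarize; [exact: dom_subspace|exact: ap_lin|by rewrite ed; exact: ap_lin|].
move=> f Df; have f1 := apP Df; have := Df; rewrite ed => /apP f2.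
apply/eqP; rewrite eq_le; have [k' /(lin_fun l1 f1) <- ->] := h2 _ _ f2.
by have [k'' /(lin_fun l2 f2) <- ->] := h1 _ _ f1.
Qed.

Lemma selfadjoint_closed (H : hilbertType R) (S : set (H * H)) :
  selfadjoint S -> closed S.
Proof. by move=> [Sl _ SE]; rewrite -SE; exact: adjoint_closed. Qed.

Lemma op_sqrtP (H : hilbertType R) (N : set (H * H)) :
  (exists S, [/\ selfadjoint S, nonneg_op S & op_comp S S = N]) ->
  [/\ selfadjoint (op_sqrt N), nonneg_op (op_sqrt N) &
      op_comp (op_sqrt N) (op_sqrt N) = N].
Proof.
by move=> h; exact: (@xgetPex _ set0 [set S | [/\ selfadjoint S, nonneg_op S & op_comp S S = N]]).
Qed.

(** The default value of [op_sqrt] has empty domain. *)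
Lemma op_sqrt_dom (H : hilbertType R) (N : set (H * H)) : dom (op_sqrt N) !=set0 ->
  [/\ selfadjoint (op_sqrt N), nonneg_op (op_sqrt N) &
      op_comp (op_sqrt N) (op_sqrt N) = N].
Proof.
move=> [f [k fk]]; apply: op_sqrtP; apply: contrapT => h.
by move: fk; rewrite /op_sqrt xgetPN// => S hS; apply: h; exists S.
Qed.

(** [A^* A] represents the form [(A f, A g)].  Any selfadjoint square root [S] of
    [A^* A] satisfies [S^* S = A^* A], so its uniqueness is not required. *)
Lemma op_sqrt_mul_adjoint (H K : hilbertType R) (A : set (H * K)) :
  linear_operator A -> closed A -> densely_defined A ->
  let N := op_comp (adjoint A) A in
  [/\ selfadjoint N, nonneg_op N, dom (op_sqrt N) = dom A &
    forall f g, dom A f -> dom A g ->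
      '[ap (op_sqrt N) f, ap (op_sqrt N) g] = '[ap A f, ap A g]].
Proof.
move=> Al Ac Ad N; have [N1 N2 /op_sqrtP[S1 S2 S3]] := mul_adjoint_selfadjoint Al Ac Ad.
have [Sl Sd Sa] := S1; have Sc := selfadjoint_closed S1.
have [|e1 e2] := mul_adjoint_eq Sl Sc Sd Al Ac Ad; first by rewrite Sa.
by split=> // f g Df Dg; apply: e2; rewrite e1.
Qed.

(** A nonnegative selfadjoint operator is determined by its form. *)
Lemma represents_unique (H K : hilbertType R) (A : set (H * K)) (N : set (H * H))
    (t : Defs.form H) : linear_operator A -> fdom t = dom A ->
  (forall f g, fdom t f -> fdom t g -> t f g = '[ap A f, ap A g]) ->
  represents N t -> N = op_comp (adjoint A) A.
Proof.
move=> Al td tE [_ _ eD eE].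
have [|[Sl Sd Sa] _ SN] := @op_sqrt_dom H N.
  by exists 0; rewrite -eD td; exact: (subspace0 (dom_subspace Al)).
rewrite -SN; set S := op_sqrt N in eD eE Sl Sd Sa *; clear SN.
have SA f g : dom A f -> dom A g -> '[ap S f, ap S g] = '[ap A f, ap A g].
  by rewrite -td => Df Dg; rewrite -eE// tE.
have dE : dom S = dom A by rewrite -eD td.
rewrite -{1}Sa; apply/seteqP; split=> -[f h] [k [/= fk kh]].
  have Df : dom A f by rewrite -dE; exists k.
  exists (ap A f); split; first exact: apP.
  move=> g l gl /=; have Dg : dom A g by exists l.
  rewrite -(apE Al gl) -SA// (apE Sl fk).
  by apply: kh; apply: apP; rewrite dE.
have Df : dom S f by rewrite dE; exists k.
exists (ap S f); split; first exact: apP.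
move=> g l gl /=; have Dg : dom S g by exists l.
rewrite dE in Df Dg.
rewrite -(apE Sl gl) SA// (apE Al fk).
by apply: kh; apply: apP.
Qed.
End VonNeumann.

(** * Nonnegative bounded extensions *)

Section Extension.
Variable R : realType.
Variables (H K : hilbertType R).
Implicit Types T B : set (H * K).

(** [param_op id F] is the graph of the function [F]. *)
Lemma graph_linear (F : K -> K) : lin F -> linear_operator (param_op id F).
Proof. by move=> Fl; exact: param_linear. Qed.

Lemma graph_ap (F : K -> K) u : lin F -> ap (param_op id F) u = F u.
Proof. by move=> Fl; apply: apE; [exact: graph_linear|exists u]. Qed.

Lemma graph_dom (F : K -> K) : dom (param_op id F) = setT.
Proof. by apply/seteqP; split=> // u _; exists (F u), u. Qed.

Lemma graph_bounded_nonneg (F : K -> K) M : lin F -> bnd F M ->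
  (forall u, 0 <= '[F u, u]) -> bounded_nonneg (param_op id F).
Proof.
move=> Fl FM Fp; split; [exact: graph_linear|exact: graph_dom| |].
  by exists M => f; rewrite graph_ap// !nrE -rmorphM lecR.
by move=> f _; rewrite graph_ap.
Qed.

Lemma opnorm_le (F : K -> K) M : lin F -> bnd F M -> 0 <= M ->
  opnorm (param_op id F) <= M.
Proof.
move=> Fl FM M0; apply: ge_sup.
  by exists (complex.Re `|ap (param_op id F) 0|), 0 => //=; rewrite normr0 ler01.
move=> _ [f /= f1 <-]; rewrite graph_ap//.
apply: le_trans (FM f) _; rewrite ler_piMr//.
by move: f1; rewrite nrE (_ : 1 = 1%:C)// lecR.
Qed.

(** A nonnegative operator given on a subspace [L] by [B f |-> T f], with
    [|T f|^2 <= lambda (T f, B f)], extends to a nonnegative operator of norm at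
    most [lambda].  Let [C] be its compression to the closure of [L] and
    [S = C^(1/2)].  The bound reads [|T f|^2 <= lambda |S B f|^2], so that
    [T = W^* S B] for some [W], which coincides with [S] on [L], and [W^* W] is
    the extension. *)
Lemma nonneg_extension T B (lambda : R) : linear_operator T -> linear_operator B ->
  0 <= lambda -> dom B `<=` dom T ->
  (forall f, dom B f -> 0 <= '[ap T f, ap B f]) ->
  (forall f, dom B f -> nr (ap T f) ^+ 2 <= lambda * ip (ap T f) (ap B f)) ->
  exists F : K -> K, [/\ lin F, bnd F lambda, forall u, 0 <= '[F u, u] &
    forall f, dom B f -> F (ap B f) = ap T f].
Proof.
move=> Tl Bl l0 BT pos0 le0; have sD := dom_subspace Bl.
have jl := ap_lin Bl.
have tl : rlin_on (dom B) (ap T) by move=> a x y Dx Dy; apply: (ap_lin Tl); exact: BT.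
have sL := image_subspace sD jl.
have TB x y : dom B x -> dom B y -> ip (ap T x) (ap B y) = ip (ap B x) (ap T y).
  exact: (nonneg_herm sD tl jl pos0).
have leT x : dom B x -> nr (ap T x) ^+ 2 <= lambda ^+ 2 * nr (ap B x) ^+ 2.
  move=> Dx; have h : nr (ap T x) ^+ 2 <= lambda * (nr (ap T x) * nr (ap B x)).
    apply: le_trans (le0 x Dx) _; apply: ler_wpM2l => //.
    exact: le_trans (ler_norm _) (ip_le _ _).
  rewrite -exprMn ler_pXn2r ?nnegrE ?mulr_ge0 ?nr_ge0//.
  have := nr_ge0 (ap T x); rewrite le_eqVlt => /orP[/eqP <-|p0].
    by rewrite mulr_ge0// nr_ge0.
  by rewrite -(ler_pM2r p0) -expr2 (le_trans h)// -mulrA (mulrC (nr (ap B x))).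
(* G is the adjoint of the map B f |-> T f from the closure of L to K. *)
have [G [Gl Gb Gc GP]] := riesz_op sD jl tl (sqr_ge0 lambda) leT.
have [|P [Pl Pb Pc PP]] := riesz_op sD jl jl ler01; first by move=> x _; rewrite mul1r.
have GM k : nr (G k) <= lambda * nr k.
  by rewrite -(ler_pXn2r (ltn0Sn 1)) ?nnegrE ?mulr_ge0 ?nr_ge0// exprMn.
have P1 k : nr (P k) <= nr k.
  by rewrite -(ler_pXn2r (ltn0Sn 1)) ?nnegrE ?nr_ge0// -[leRHS]mul1r.
have PclL u x : closure (ap B @` dom B) x -> ip x (P u) = ip x u.
  move=> hx; apply/eqP; rewrite -subr_eq0 -ipNr -ipDr; apply/eqP.
  by apply: closure_orth hx => _ [f Df <-]; rewrite !ipE PP// subrr.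
have PB f : dom B f -> P (ap B f) = ap B f.
  move=> Df; apply: (closure_sub_eq sL (Pc _)); first by apply: subset_closure; exists f.
  by move=> _ [g Dg <-]; rewrite PP.
have Gcvg u a : u @ \oo --> a -> (fun n => G (u n)) @ \oo --> G a.
  by apply: (cvg_bounded (M := lambda)) => // x y; rewrite (linB _ _ Gl).
have Gsym a b : closure (ap B @` dom B) a -> closure (ap B @` dom B) b ->
    ip (G a) b = ip a (G b).
  move=> /closureP_seq[u Lu ua] /closureP_seq[v Lv vb].
  apply: (cvgR_unique (cvg_ip (Gcvg _ _ ua) vb)).
  rewrite (_ : (fun n => _) = (fun n => ip (u n) (G (v n)))).
    exact: (cvg_ip ua (Gcvg _ _ vb)).
  apply/funext => n; have [f Df <-] := Lu n; have [g Dg <-] := Lv n.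
  by rewrite ipC !GP// TB// ipC.
have Gpos a : closure (ap B @` dom B) a -> 0 <= ip (G a) a.
  move=> /closureP_seq[u Lu ua].
  apply: (ler_cvg_to (cvg_cst 0) (cvg_ip (Gcvg _ _ ua) ua)); near=> n.
  have [f Df <-] := Lu n; rewrite ipC GP//.
  by have /ge0_ReP[] := pos0 f Df.
(* P is the orthogonal projection onto the closure of L. *)
pose C u := G (P u).
have Cl : lin C by move=> a x y _ _; rewrite /C (linP _ _ _ Pl) (linP _ _ _ Gl).
have Cs : sym C.
  by move=> x y; rewrite /C -(PclL y)// Gsym// ipC PclL// ipC.
have Cp : pos C by move=> x; rewrite /C -PclL// Gpos.
have CM : bnd C lambda.
  by move=> x; apply: le_trans (GM _) _; apply: ler_wpM2l.
have [S [Sl Ss Sp SS]] := sqrt_bounded Cl Cs Cp CM.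
have SB f g : dom B f -> dom B g -> ip (S (ap B f)) (S (ap B g)) = ip (ap T f) (ap B g).
  by move=> Df Dg; rewrite -Ss SS /C PB// ipC GP// TB// ipC.
have Sjl : rlin_on (dom B) (fun f => S (ap B f)).
  by move=> a x y Dx Dy; rewrite jl// (linP _ _ _ Sl).
have [|W [Wl Wb Wc WP]] := riesz_op sD Sjl tl l0.
  by move=> x Dx; rewrite -[nr (S _) ^+ 2]ipuu SB// le0.
have WB f : dom B f -> W (ap B f) = S (ap B f).
  move=> Df; apply: (closure_sub_eq (image_subspace sD Sjl) (Wc _)).
    by apply: subset_closure; exists f.
  by move=> _ [g Dg <-]; rewrite WP// SB.
have Wb' x : [set: K] x -> nr (W x) ^+ 2 <= lambda * nr x ^+ 2 by [].
have idl : rlin_on [set: K] id by [].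
have [V [Vl Vb _ VP]] := riesz_op (@subspaceT R K) idl Wl l0 Wb'.
have VWE u v : ip (V (W u)) v = ip (W u) (W v) by rewrite ipC (VP _ v)// ipC.
exists (fun u => V (W u)); split.
- by move=> a x y _ _; rewrite (linP _ _ _ Wl) (linP _ _ _ Vl).
- move=> x; rewrite -(ler_pXn2r (ltn0Sn 1)) ?nnegrE ?mulr_ge0 ?nr_ge0// exprMn.
  apply: le_trans (Vb _) _; rewrite expr2 -mulrA; apply: ler_wpM2l => //; exact: Wb.
- move=> u; have -> : '[V (W u), u] = '[W u, W u].
    apply: complexify; first exact: VWE.
    have := VWE ('i *: u) u; rewrite (linZ _ _ Wl) (linZ _ _ Vl); exact.
  by rewrite inner_norm exprn_ge0.
- by move=> f Df; apply: ip_eq => w; rewrite VWE WB// WP.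
Unshelve. all: by end_near.
Qed.

(** [cond_a] in real terms; [(Tf, Bf)] is nonnegative also for the constant 0,
    since [T] then vanishes on [dom B]. *)
Lemma cond_aP T B : cond_a T B -> dom B `<=` dom T /\
  exists lambda : R, [/\ 0 <= lambda,
  forall f, dom B f -> 0 <= '[ap T f, ap B f] &
  forall f, dom B f -> nr (ap T f) ^+ 2 <= lambda * ip (ap T f) (ap B f)].
Proof.
move=> [BT [l l0 h]]; split=> //.
have h' f : dom B f -> 0 <= l%:C * '[ap T f, ap B f].
  by move=> Df; apply: le_trans (h f Df); rewrite exprn_ge0.
move: l0; rewrite le_eqVlt => /orP[/eqP e|l0].
  have T0 f : dom B f -> ap T f = 0.
    move=> /h; rewrite -e mul0r => h0; apply/eqP; rewrite -normr_eq0 -sqrf_eq0.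
    by rewrite eq_le h0 exprn_ge0.
  exists 0; split=> // f Df; rewrite T0//; first by rewrite linear0l.
  by rewrite nr0 mul0r expr0n.
exists l; split; first exact: ltW.
  by move=> f Df; have := h' f Df; rewrite pmulr_rge0// ltcR.
move=> f Df; have := h f Df; rewrite -inner_norm -ReZ.
by rewrite inner_norm nrE -rmorphXn lecE => /andP[].
Qed.

Lemma cond_a_b T B : linear_operator T -> linear_operator B -> cond_a T B -> cond_b T B.
Proof.
move=> Tl Bl /cond_aP[BT [l [l0 h1 h2]]].
have [F [Fl Fb Fp FT]] := nonneg_extension Tl Bl l0 BT h1 h2.
exists l => //; exists (param_op id F); split.
- exact: (graph_bounded_nonneg Fl Fb Fp).
- exact: (opnorm_le Fl Fb l0).
move=> [f k] [b [/= fb [u e]]] /=; case: e fb => -> -> /= fb.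
have Df : dom B f by exists u.
rewrite -(apE Bl fb) FT//; apply: apP; exact: BT.
Qed.
End Extension.

(** * Closures of forms *)

Section FormClosure.
Variable R : realType.

Lemma near2P (P : nat -> nat -> Prop) :
  (\forall n \near \oo & m \near \oo, P n m) <->
  exists N, forall n m, (N <= n)%N -> (N <= m)%N -> P n m.
Proof.
split=> [[[A B] [[N _ hN] [M _ hM]] h]|[N hN]].
  exists (maxn N M) => n m; rewrite !geq_max => /andP[Nn _] /andP[_ Mm].
  by apply: (h (n, m)); split; [exact: hN|exact: hM].
by exists ([set n | (N <= n)%N], [set n | (N <= n)%N]); [split; exists N|
  move=> [n m] /= [? ?]; exact: hN].
Qed.

Lemma nearP (P : nat -> Prop) : (\forall n \near \oo, P n) <->
  exists N, forall n, (N <= n)%N -> P n.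
Proof. by split=> [[N _ h]|[N h]]; exists N. Qed.

Section Forms.
Variable H : hilbertType R.
Implicit Types s t : Defs.form H.

Lemma fdom_subspace t : nonneg_form t -> subspace (fdom t).
Proof. by case. Qed.

Lemma form_expand t f g a : nonneg_form t -> fdom t f -> fdom t g ->
  t (a *: f + g) (a *: f + g) = a * a^* * t f f + a * t f g + a^* * t g f + t g g.
Proof.
move=> nt Df Dg; have Dfg := subspaceP (fdom_subspace nt) a Df Dg.
have [_ _ l r _] := nt; rewrite l// !r//; ring.
Qed.

(** Complex polarization: on a common domain, a form is determined by its
    quadratic form. *)
Lemma form_polarize s t : nonneg_form s -> nonneg_form t -> fdom t `<=` fdom s ->
  (forall f, fdom t f -> s f f = t f f) ->
  forall f g, fdom t f -> fdom t g -> s f g = t f g.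
Proof.
move=> ns nt ts h f g Df Dg.
have Df' := ts _ Df; have Dg' := ts _ Dg.
have e a : a * (s f g - t f g) + a^* * (s g f - t g f) = 0.
  have := h _ (subspaceP (fdom_subspace nt) a Df Dg).
  rewrite !form_expand// !h// => /eqP; rewrite -subr_eq0 => /eqP e.
  by rewrite -e; ring.
have := e 1; rewrite rmorph1 !mul1r => e1.
have : 'i%C * (s f g - t f g) + (- 'i%C) * (s g f - t g f) = 0.
  by rewrite -(e 'i%C); congr (_ + _ * _); apply/eqP; rewrite eq_complex /= oppr0 !eqxx.
rewrite mulNr -mulrBr => /eqP.
rewrite mulf_eq0 => /orP[/eqP/(congr1 (@complex.Im R))/=/eqP|/eqP e2].
  by rewrite oner_eq0.
apply/eqP; rewrite -subr_eq0; apply/eqP.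
have : 2 * (s f g - t f g) = 0 by rewrite -[RHS](addr0 0) -{1}e1 -e2; ring.
by move/eqP; rewrite mulf_eq0 pnatr_eq0 => /= /eqP.
Qed.

(** The quadratic form is continuous along sequences converging for the form. *)
Lemma form_cvg t (u : nat -> H) f : nonneg_form t -> (forall n, fdom t (u n)) ->
  fdom t f ->
  (forall e : R, 0 < e -> \forall n \near \oo, t (u n - f) (u n - f) < e%:C) ->
  (fun n => complex.Re (t (u n) (u n))) @ \oo --> complex.Re (t f f).
Proof.
move=> nt Du Df h; have sD := fdom_subspace nt.
pose q g := complex.Re (t g g).
have q0 g : fdom t g -> 0 <= q g.
  by move=> Dg; have [_ _ _ _ /(_ g Dg) /ge0_ReP[]] := nt.
pose b x y := complex.Re (t x y) + complex.Re (t y x).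
have qe x y (a : R) : fdom t x -> fdom t y ->
    q (a%:C *: x + y) = a ^+ 2 * q x + a * b x y + q y.
  have aC : Num.conj (a%:C : R[i]) = a%:C := conjc_real a.
  move=> Dx Dy; rewrite /q /b form_expand// aC -rmorphM !ReD !ReZ; ring.
have bCS x y : fdom t x -> fdom t y -> (b x y) ^+ 2 <= 4 * (q x * q y).
  move=> Dx Dy; suff : (b x y / 2) ^+ 2 <= q x * q y by rewrite expr_div_n; lra.
  apply: discr_le => [|a]; first exact: q0.
  have := q0 _ (subspaceP sD a%:C Dx Dy); rewrite qe//; lra.
apply/cvg_RP => e e0; have qf := q0 _ Df.
pose d := Num.min (e / 2) (e ^+ 2 / (16 * (q f + 1))).
have d0 : 0 < d.
  by rewrite lt_min !divr_gt0 ?exprn_gt0 ?mulr_gt0//; lra.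
have /nearP[N hN] := h d d0; exists N => n /hN hn.
have Dh := subspaceB sD (Du n) Df.
have hq : q (u n - f) < d by move: hn; rewrite ltcE => /andP[].
rewrite -/(q (u n)) -/(q f).
have -> : q (u n) = q (u n - f) + b (u n - f) f + q f.
  by have := qe (u n - f) f 1 Dh Df; rewrite rmorph1 scale1r subrK => ->; ring.
have d1 : d <= e / 2 by rewrite ge_min lexx.
have d2 : d * (16 * (q f + 1)) <= e ^+ 2.
  by rewrite -ler_pdivlMr ?ge_min ?lexx ?orbT// mulr_gt0//; lra.
rewrite addrK; apply: le_lt_trans (ler_normD _ _) _; rewrite ger0_norm ?q0//.
have qh := q0 _ Dh.
have : `|b (u n - f) f| <= e / 2.
  rewrite -(ler_pXn2r (ltn0Sn 1)) ?nnegrE ?normr_ge0//; last lra.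
  rewrite real_normK ?num_real//; apply: le_trans (bCS _ _ Dh Df) _.
  have : q (u n - f) * q f <= d * (q f + 1) by apply: ler_pM => //; lra.
  lra.
lra.
Qed.

(** The form [(A f, A g)] of an operator. *)
Definition op_form (K : hilbertType R) (A : set (H * K)) : Defs.form H :=
  Form (dom A) (fun f g => '[ap A f, ap A g]).

Section OpForm.
Variables (K : hilbertType R) (A : set (H * K)).
Hypothesis Al : linear_operator A.

Lemma op_form_nonneg : nonneg_form (op_form A).
Proof.
have sD := dom_subspace Al; have l := ap_lin Al; split=> /=.
- exact: subspace0.
- by move=> a f g; exact: subspaceP.
- by move=> a f g h Df Dg _; rewrite l// linearPl.
- by move=> a f g h Df Dg _; rewrite l// linearPr.
- by move=> f _; rewrite inner_norm exprn_ge0.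
Qed.

Lemma op_formB f g : dom A f -> dom A g ->
  op_form A (f - g) (f - g) = (nr (ap A f - ap A g) ^+ 2)%:C.
Proof.
move=> Df Dg; rewrite /op_form /= (rlinB (ap_lin Al))// inner_norm nrE.
by rewrite rmorphXn.
Qed.

Lemma op_form_closed : closed A -> closed_form (op_form A).
Proof.
move=> Ac; split; first exact: op_form_nonneg.
move=> u f Du uf hu.
have [k uk] : exists k : K, (fun n => ap A (u n)) @ \oo --> k.
  apply: nr_complete => e e0; have /near2P[N hN] := hu _ (exprn_gt0 2 e0).
  exists N => n m Nn Nm; have := hN n m Nn Nm; rewrite op_formB; [|exact: Du|exact: Du].
  by rewrite ltcR ltr_pXn2r ?nnegrE ?nr_ge0// ltW.
have fk : A (f, k) by apply: (closed_pair Ac _ uf uk) => n; apply: apP; exact: Du.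
have Df : dom A f by exists k.
split=> // e e0; have /cvg_nrP/(_ (Num.sqrt e)) := uk.
rewrite sqrtr_gt0 => /(_ e0)[N hN]; apply/nearP; exists N => n /hN hn.
rewrite op_formB; [|exact: Du|exact: Df]; rewrite ltcR (apE Al fk).
by rewrite -[e]sqr_sqrtr ?(ltW e0)// ltr_pXn2r ?nnegrE ?nr_ge0 ?sqrtr_ge0.
Qed.

(** When [dom t] is a core of [A] and [t] agrees there with the form of [A], the
    form of [A] is the closure of [t]. *)
Lemma op_form_closure t : closed A -> subspace (fdom t) -> form_extends (op_form A) t ->
  (forall f, dom A f -> exists u : nat -> H, [/\ forall n, fdom t (u n), u @ \oo --> f &
     (fun n => ap A (u n)) @ \oo --> ap A f]) ->
  nonneg_form t /\ is_form_closure t (op_form A).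
Proof.
move=> Ac sD [tA At] core; have nA := op_form_nonneg.
split.
  have [_ _ l r p] := nA; split.
  - exact: subspace0.
  - by move=> a f g; exact: subspaceP.
  - move=> a f g h Df Dg Dh; rewrite -!At//; last exact: subspaceP.
    by rewrite l//; exact: tA.
  - move=> a f g h Df Dg Dh; rewrite -!At//; last exact: subspaceP.
    by rewrite r//; exact: tA.
  - by move=> f Df; rewrite -At// p//; exact: tA.
split; [exact: op_form_closed|by []|].
move=> s [ns cs] [ts st].
have key f : dom A f -> fdom s f /\ s f f = op_form A f f.
  move=> Df; have [u [Du uf Auf]] := core f Df.
  have DAu n : dom A (u n) by exact: tA.
  have [|e e0|Dsf hf] := cs u f _ uf; first by move=> n; exact: ts.
    apply/near2P; have e1 : 0 < Num.sqrt e / 2 by rewrite divr_gt0 ?sqrtr_gt0.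
    have [N hN] := (cvg_nrP _ _).1 Auf _ e1; exists N => n m /hN hn /hN hm.
    have D := subspaceB sD (Du n) (Du m).
    rewrite st// -At// op_formB// ltcR.
    rewrite -[e]sqr_sqrtr ?(ltW e0)// ltr_pXn2r ?nnegrE ?nr_ge0 ?sqrtr_ge0//.
    rewrite -(subrK (ap A f) (ap A (u n))) -addrA.
    apply: le_lt_trans (nrD _ _) _; rewrite (nrB (ap A f)); lra.
  split=> //; have sn0 n : fdom s (u n) by exact: ts.
  have h1 := form_cvg ns sn0 Dsf hf.
  have h2 := cvg_ip Auf Auf.
  have [_ _ _ _ p] := ns.
  rewrite (ge0_Re (p _ Dsf)) /= inner_norm nrE -rmorphXn -ipuu; congr (_%:C).
  apply: (cvgR_unique h1).
  rewrite (_ : (fun n => _) = (fun n => ip (ap A (u n)) (ap A (u n)))) //.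
  by apply/funext => n; rewrite st// -At.
split; first by move=> f /key[].
by apply: form_polarize => // f /key[].
Qed.

End OpForm.

(** This holds without closability, as [form_closure t] is then [t]. *)
Lemma form_closure_extends t : form_extends (form_closure t) t.
Proof.
rewrite /form_closure; case: xgetP => [s _ [_ + _] //|_]; by split.
Qed.

Lemma form_closureP t s : is_form_closure t s ->
  is_form_closure t (form_closure t) /\ form_extends s (form_closure t) /\
  form_extends (form_closure t) s.
Proof.
move=> hs; have h : is_form_closure t (form_closure t).
  by apply: (@xgetPex _ t [set s | is_form_closure t s]); exists s.
by split=> //; have [c1 x1 m1] := hs; have [c2 x2 m2] := h; split; auto.
Qed.

End Forms.
End FormClosure.

(** * The form (Tf, Bg) *)

Section Factor.
Variable R : realType.

(** The square root of a bounded nonnegative operator [X], as an everywhere defined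
    function [s] with [|s u|^2 <= M |u|^2]. *)
Lemma bounded_sqrt (K : hilbertType R) (X : set (K * K)) : bounded_nonneg X ->
  exists s : K -> K, exists M : R, [/\ [/\ lin s, sym s & 0 <= M],
    op_sqrt X = param_op id s,
    X = param_op id (fun u => s (s u)) & forall u, nr (s u) ^+ 2 <= M * nr u ^+ 2].
Proof.
move=> [Xl Xd [M0 XM] Xp]; pose F := ap X; pose M := `|M0|.
have XF u : X (u, F u) by apply: apP; rewrite Xd.
have Fl : lin F by move=> a x y _ _; apply: (ap_lin Xl); rewrite Xd.
have FM : bnd F M.
  move=> u; have := XM u; rewrite !nrE -rmorphM lecR => h; apply: le_trans h _.
  by rewrite ler_wpM2r ?nr_ge0// ler_norm.
have F0 u : 0 <= '[F u, u] by apply: Xp; rewrite Xd.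
have Fs : sym F.
  have idl : rlin_on [set: K] id by [].
  by move=> x y; apply: (nonneg_herm (@subspaceT R K) Fl idl).
have Fp : pos F by move=> x; have /ge0_ReP[] := F0 x.
have XE : X = param_op id F.
  apply/seteqP; split=> [[u v] uv|_ [u ->] //]; exists u.
  by rewrite (lin_fun Xl uv (XF u)).
have [S [Sl Ss Sp SS]] := sqrt_bounded Fl Fs Fp FM.
have sqrt_ex : exists S, [/\ selfadjoint S, nonneg_op S & op_comp S S = X].
  exists (param_op id S); split.
  - by apply: param_selfadjoint => // f h e; exists f.
  - by move=> f _; rewrite graph_ap//; exact: sym_pos_inner.
  - rewrite XE; apply/seteqP; split=> -[f h].
      by move=> [k [[u [/= -> ->]] [v [/= <- ->]]]]; exists u; rewrite SS.
    move=> [u [-> ->]]; exists (S u); split; first by exists u.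
    by exists (S u); rewrite /= SS.
(* The square root is unique, but it is enough that any square root of X is
   everywhere defined. *)
have [[Tl _ Ta] _ TT] := op_sqrtP sqrt_ex.
set T := op_sqrt X in Tl Ta TT *.
have Td u : dom T u by have := XF u; rewrite -TT => -[k [/= uk _]]; exists k.
pose s := ap T.
have Ts u : T (u, s u) by exact: apP.
have sl : lin s by move=> a x y _ _; exact: (ap_lin Tl).
have TE : T = param_op id s.
  apply/seteqP; split=> [[u v] uv|_ [u ->] //]; exists u.
  by rewrite (lin_fun Tl uv (Ts u)).
have ssym : sym s.
  by move=> x y; have := Ts y; rewrite -{1}Ta => /(adjointP _ _ Tl); exact.
have ss u : s (s u) = F u.
  by apply: (lin_fun Xl _ (XF u)); rewrite -TT; exists (s u).
exists s, M; split=> //.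
- by split=> //; exact: normr_ge0.
- by rewrite XE; congr param_op; apply/funext => u; rewrite ss.
move=> u; rewrite -ipuu -ssym ss; apply: le_trans (ler_norm _) _.
by apply: le_trans (ip_le _ _) _; rewrite expr2 mulrA ler_wpM2r ?nr_ge0.
Qed.

Section Fix.
Variables (H K : hilbertType R) (T B : set (H * K)) (X : set (K * K)).
Hypotheses (Tl : linear_operator T) (Tc : closed T) (Bl : linear_operator B)
  (Bd : densely_defined B).
Hypotheses (Xb : bounded_nonneg X) (XB_T : op_comp X B `<=` T).

Lemma factor_cond_a : cond_a T B.
Proof.
have [s [M [[sl ss M0] _ XE sM]]] := bounded_sqrt Xb.
have BT f b : B (f, b) -> T (f, s (s b)).
  by move=> fb; apply: XB_T; exists b; split=> //; rewrite XE; exists b.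
split; first by move=> f [b /BT ?]; exists (s (s b)).
exists M => // f [b fb]; rewrite (apE Tl (BT _ _ fb)) (apE Bl fb).
have -> : '[s (s b), b] = '[s b, s b].
  by apply: complexify; rewrite -?ss ?(linZ _ _ sl).
by rewrite inner_norm !nrE -!rmorphXn -rmorphM lecR.
Qed.

Let XB := op_comp (op_sqrt X) B.
Let A := closure XB.
Let Hop := op_comp (adjoint B) (op_comp (op_sqrt X) A).
Let t := tau T B.

(** The common core: [A], the closure of [X^(1/2) B], is a closed operator whose
    form is the closure of [(Tf, Bg)], [B^* X^(1/2) A] is [A^* A], and
    [T f = X^(1/2) A f] on [dom A]. *)
Lemma factor_main : [/\ [/\ linear_operator A, densely_defined A &
    Hop = op_comp (adjoint A) A],
  nonneg_form t /\ is_form_closure t (op_form A) &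
  exists M : R, [/\ 0 <= M, dom A `<=` dom T & forall f, dom A f ->
    nr (ap T f) ^+ 2 <= M * nr (ap A f) ^+ 2]].
Proof.
have [s [M [[sl ss M0] SE XE sM]]] := bounded_sqrt Xb.
have BT f b : B (f, b) -> T (f, s (s b)).
  by move=> fb; apply: XB_T; exists b; split=> //; rewrite XE; exists b.
have XBE f l : XB (f, l) <-> exists2 b, B (f, b) & l = s b.
  rewrite /XB SE; split=> [[b [/= fb [u e]]]|[b fb ->]].
    by case: e fb => -> -> fb; exists u.
  by exists b; split=> //; exists b.
have scvg u a : u @ \oo --> a -> (fun n => s (u n)) @ \oo --> s a.
  apply: (cvg_bounded (M := Num.sqrt M)) => [x y|x]; first by rewrite (linB _ _ sl).
  rewrite -(ler_pXn2r (ltn0Sn 1)) ?nnegrE ?mulr_ge0 ?nr_ge0 ?sqrtr_ge0//.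
  by rewrite exprMn sqr_sqrtr.
(* Every point of A is approximated along the graph of B. *)
have AP f l : A (f, l) <-> exists u b, [/\ forall n, B (u n, b n), u @ \oo --> f &
    (fun n => s (b n)) @ \oo --> l].
  rewrite /A closure_pairP; split=> [[u [v [uv uf vl]]]|[u [b [ub uf bl]]]].
    have hb n : exists b, B (u n, b) /\ v n = s b by have /XBE[b] := uv n; exists b.
    have [b {}hb] := choice hb; exists u, b; split=> // [n|]; first by have [] := hb n.
    by rewrite (_ : (fun n => _) = v)//; apply/funext => n; have [_ ->] := hb n.
  by exists u, (fun n => s (b n)); split=> // n; apply/XBE; exists (b n).
have BA f b : B (f, b) -> A (f, s b).
  by move=> fb; apply: subset_closure; apply/XBE; exists b.
have AT f l : A (f, l) -> T (f, s l).
  move=> /AP[u [b [ub uf bl]]]; apply: (closed_pair Tc _ uf (scvg _ _ bl)) => n.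
  exact: BT.
have sB := lin_subspace Bl.
have Asub : subspace A.
  split; first by have := BA _ _ (subspace0 sB); rewrite lin0.
  move=> a [f l] [g m] /AP[u [b [ub uf bl]]] /AP[v [c [vc vg cm]]]; apply/AP.
  exists (fun n => a *: u n + v n), (fun n => a *: b n + c n); split.
  - by move=> n; exact: (subspaceP sB a (ub n) (vc n)).
  - by apply: cvgD => //; exact: cvgZr.
  - rewrite (_ : (fun n => _) = (fun n => a *: s (b n) + s (c n))).
      by apply: cvgD => //; exact: cvgZr.
    by apply/funext => n; rewrite (linP _ _ _ sl).
(* A limit k of values of X^(1/2) along a null sequence lies in the closure of
   the range of X^(1/2), and in its kernel because T is closed. *)
have A0 k : A (0, k) -> k = 0.
  move=> Ak; have sk : s k = 0.
    exact: (lin_fun Tl (AT _ _ Ak) (subspace0 (lin_subspace Tl))).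
  have /AP[u [b [_ _ bk]]] := Ak; apply: ip_eq0.
  apply: (@closure_orth _ _ (range s)).
    by move=> _ [x _ <-]; rewrite ss sk ip0r.
  by apply/closureP_seq; exists (fun n => s (b n)) => // n; exists (b n).
have Al : linear_operator A.
  split; [exact: (subspace0 Asub)|by move=> a p q; exact: (subspaceP Asub)|].
  move=> f k k' h h'; apply/eqP; rewrite -subr_eq0; apply/eqP/A0.
  by have := subspaceB Asub h h'; rewrite /= -[(f, k) - _]/(f - f, k - k') subrr.
have Ac : closed A by exact: closed_closure.
have BdA : dom B `<=` dom A by move=> f [b /BA ?]; exists (s b).
have Ad : densely_defined A.
  move=> O O0 Oo; have [f [Of Bf]] := Bd O0 Oo; exists f; split=> //; exact: BdA.
have HE : Hop = op_comp (adjoint A) A.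
  apply/seteqP; split=> -[f h] [k [/= ]].
    rewrite SE => -[l [/= fl [u e]]]; case: e fl => -> -> /= fl ah.
    exists u; split=> //; apply/adjointP => // g m /AP[v [b [vb vg bm]]].
    apply: (cvgR_unique (cvg_ipl u bm)).
    rewrite (_ : (fun n => _) = (fun n => ip (v n) h)); first exact: cvg_ipl.
    by apply/funext => n; rewrite ss; have /adjointP := ah; apply.
  move=> fk ah; exists (s k); split.
    by exists k; split=> //; rewrite SE; exists k.
  apply/adjointP => // g b gb; rewrite -ss.
  by have /adjointP := ah; apply=> //; exact: BA.
have tA : form_extends (op_form A) t.
  split=> //= f g [b fb] [c gc].
  rewrite (apE Al (BA _ _ fb)) (apE Al (BA _ _ gc)) (apE Tl (BT _ _ fb)) (apE Bl gc).
  by apply: complexify; rewrite -ss ?(linZ _ _ sl).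
split=> //.
  apply: op_form_closure => //; first exact: dom_subspace.
  move=> f /apP Af; have /AP[u [b [ub uf bl]]] := Af; exists u; split=> //.
    by move=> n; exists (b n).
  rewrite (_ : (fun n => _) = (fun n => s (b n)))//; apply/funext => n.
  by rewrite (apE Al (BA _ _ (ub n))).
exists M; split=> // [f [l /AT fl]|f /apP fl]; first by exists (s l).
by rewrite (apE Tl (AT _ _ fl)).
Qed.

Lemma factor_closure : let tbar := form_closure t in
  [/\ closable_form t, is_form_closure t tbar, fdom tbar = dom A &
    forall f g, fdom tbar f -> fdom tbar g -> tbar f g = '[ap A f, ap A g]].
Proof.
move=> tbar; have [[Al Ad HE] [nt ct] _] := factor_main.
have [ctb [[h1 e1] [h2 e2]]] := form_closureP ct.
split=> //.
- by split=> //; exists (op_form A); have [] := ct.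
- by apply/seteqP; split.
- by move=> f g Df Dg; rewrite -e1.
Qed.

Lemma factor_represents : let tbar := form_closure t in
  [/\ selfadjoint Hop, nonneg_op Hop, represents Hop tbar
    & forall H', represents H' tbar -> H' = Hop].
Proof.
move=> tbar; have [[Al Ad HE] _ _] := factor_main.
have Ac : closed A by exact: closed_closure.
have [_ _ dE tE] := factor_closure.
have [] := op_sqrt_mul_adjoint Al Ac Ad; rewrite -HE => N1 N2 N3 N4; split=> //.
  split=> //; first by rewrite N3.
  by move=> f g Df Dg; rewrite tE// N4// -dE.
by move=> H' hH'; rewrite HE; exact: (represents_unique Al dE tE hH').
Qed.

Lemma factor_cond_2 : cond_2 T B.
Proof.
have [_ _ [M [M0 AT hM]]] := factor_main.
have [ct _ dE tE] := factor_closure.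
split=> //; exists M => //; split=> [|f Df]; first by rewrite dE.
rewrite tE//= !inner_norm !nrE -!rmorphXn -rmorphM lecR hM//.
by rewrite -dE.
Qed.

Lemma factor_cond_3 : cond_3 T B.
Proof.
have [_ _ [M [M0 AT hM]]] := factor_main.
have [ct _ dE tE] := factor_closure.
have [_ _ rep _] := factor_represents; have [_ _ sE sV] := rep.
split=> //; exists Hop => //; exists M => //; split=> [|f]; rewrite -sE dE// => Df.
have Df' : fdom (form_closure t) f by rewrite dE.
rewrite -[`|ap (op_sqrt _) f| ^+ 2]inner_norm -sV// tE// inner_norm !nrE -!rmorphXn -rmorphM lecR.
exact: hM.
Qed.
End Fix.

Lemma cond_2_a (H K : hilbertType R) (T B : set (H * K)) : cond_2 T B -> cond_a T B.
Proof.
move=> [_ [l l0 [h1 h2]]]; have [e1 e2] := form_closure_extends (tau T B).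
split=> [f Bf|]; first by apply: h1; exact: e1.
exists l => // f Bf; have := h2 f (e1 _ Bf).
by rewrite e2//= inner_norm.
Qed.

Lemma cond_3_a (H K : hilbertType R) (T B : set (H * K)) : cond_3 T B -> cond_a T B.
Proof.
move=> [ct [N [_ _ sE sV] [l l0 [h1 h2]]]]; apply: cond_2_a; split=> //.
exists l => //; split=> [|f Df]; first by rewrite sE.
by rewrite /= inner_norm sV// inner_norm h2// -sE.
Qed.

Lemma cond_1_a (H K : hilbertType R) (T B : set (H * K)) : cond_1 T B <-> cond_a T B.
Proof.
split=> [[l l0 [h1 h2]]|[h1 [l l0 h2]]].
  by split=> //; exists l => // f Bf; rewrite -inner_norm; exact: h2.
by exists l => //; split=> // f Bf /=; rewrite inner_norm; exact: h2.
Qed.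

End Factor.

Theorem theorem2p2 (R : realType) (H K : hilbertType R) (T B : set (H * K))
    (T_lin : linear_operator T) (T_closed : closed T)
    (T_dense : densely_defined T)
    (B_lin : linear_operator B) (B_closed : closed B)
    (B_dense : densely_defined B) :
  [/\ (cond_a T B <-> cond_b T B),
      (forall (lambda : R) (X : set (K * K)),
        0 <= lambda -> factor_b T B lambda X ->
        let t := tau T B in
        let tbar := form_closure t in
        let XB := op_comp (op_sqrt X) B in
        let A := closure XB in
        let Hop := op_comp (adjoint B) (op_comp (op_sqrt X) A) in
        [/\ closable_form t /\ is_form_closure t tbar,
            closable_op XB /\ fdom tbar = dom A,
            (forall f g, fdom tbar f -> fdom tbar g ->
               tbar f g = '[ap A f, ap A g] /\
               tbar f g = '[ap (op_sqrt Hop) f, ap (op_sqrt Hop) g]),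
            [/\ selfadjoint Hop, nonneg_op Hop, represents Hop tbar
              & forall H', represents H' tbar -> H' = Hop]
          & fdom tbar = dom (op_sqrt Hop) /\ dom (op_sqrt Hop) `<=` dom T])
    & [/\ (cond_a T B <-> cond_1 T B),
          (cond_a T B <-> cond_2 T B)
        & (cond_a T B <-> cond_3 T B)]].
Proof.
have ab : cond_a T B <-> cond_b T B.
  split; first exact: cond_a_b.
  by move=> [l l0 [X [Xb _ XT]]]; exact: factor_cond_a XT.
split=> //; last first.
  split.
  - by split; [move=> /cond_1_a|move=> /cond_1_a].
  - split; last exact: cond_2_a.
    by move=> /ab[l l0 [X [Xb _ XT]]]; exact: factor_cond_2 Xb XT.
  - split; last exact: cond_3_a.
    by move=> /ab[l l0 [X [Xb _ XT]]]; exact: factor_cond_3 Xb XT.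
move=> lambda X l0 [Xb _ XT] t tbar XB A Hop.
have [[Al _ _] _ [M [_ AT _]]] := factor_main T_lin T_closed B_lin B_dense Xb XT.
have [ct ctb dE tE] := factor_closure T_lin T_closed B_lin B_dense Xb XT.
have [N1 N2 rep uni] := factor_represents T_lin T_closed B_lin B_dense Xb XT.
have [_ _ sE sV] := rep.
split=> //.
- by move=> f g Df Dg; split; [exact: tE|exact: sV].
- by rewrite -sE; split=> //; rewrite dE.
Qed.
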